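(* Let $\mathbf M$ and $\mathbf M'$ be irreducible vector operators over $\mathcal D_\star$ with $D<D'$ components such that $\mathbf M'$ implies $\mathbf M$. Let $\mathfrak q$ be the $I$-projection of the reference distribution $\upsilon$ onto the ambient TOTEMplex $[\mathfrak f;\mathbf M]$, where $\upsilon_e>0$ and $q_e>0$ for all $e\in\mathcal D_\star$. For $\mathfrak p\in[\mathfrak f;\mathbf M]$ let $\mathfrak q'(\mathfrak p)$ denote the $I$-projection of $\upsilon$ onto the inner TOTEMplex $[\mathfrak p;\mathbf M']\subset[\mathfrak f;\mathbf M]$. For each $N$ let $\mathfrak p_N$ be a random element of $[\mathfrak f;\mathbf M]$ with density proportional to $\exp\{-N D(\mathfrak p\|\upsilon)\}$ with respect to Lebesgue measure on the affine space $\mathfrak q+\ker\mathbf M$ restricted to $[\mathfrak f;\mathbf M]$. Then the statistic $$2N\,D\big(\mathfrak q'(\mathfrak p_N)\,\|\,\mathfrak q\big),$$ which depends only on the inner TOTEMplex $[\mathfrak p_N;\mathbf M']$ containing $\mathfrak p_N$, converges in distribution, as $N\to\infty$, to the chi-squared distribution with $D'-D$ degrees of freedom.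
   Context: $\mathcal D$ is a finite set of configurations and $\mathcal D_\star\subseteq\mathcal D$ is the nonempty subset of admissible ones. $\mathcal P(\mathcal D_\star)$ is the simplex of $\mathfrak p=(p_e)_{e\in\mathcal D_\star}$ with $p_e\ge0$, $\sum_e p_e=1$. The empirical distribution $\mathfrak f$ is a probability distribution on $\mathcal D$ with $f_e=0$ for $e\notin\mathcal D_\star$; $\mathfrak f$, $\upsilon$, $\mathbf M$ and $\mathbf M'$ are held fixed as $N\to\infty$. The reference $\upsilon$ is a probability distribution on $\mathcal D$. An irreducible vector operator $\mathbf M$ over $\mathcal D_\star$ is a tuple $(m_1,\dots,m_D)$ of linearly independent functions $m_\alpha:\mathcal D_\star\to\mathbb R$; by convention the constant function $1$ lies in their linear span (normalization). Its kernel is $\ker\mathbf M=\{\pi\in\mathbb R^{\mathcal D_\star}:\sum_e m_\alpha(e)\pi_e=0\ \text{for all }\alpha\}$. $\mathbf M'$ (with $D'$ components) implies $\mathbf M$ (with $D<D'$ components) if $m_\alpha=\sum_{\alpha'=1}^{D'}S_{\alpha\alpha'}m'_{\alpha'}$ for $\alpha=1,\dots,D$ with some real matrix $S$ of rank $D$. For a distribution $\mathfrak g\in\mathcal P(\mathcal D_\star)$, the TOTEMplex is $[\mathfrak g;\mathbf M]=\{\mathfrak p\in\mathcal P(\mathcal D_\star):\sum_{e}m_\alpha(e)p_e=\sum_{e}m_\alpha(e)g_e\ \text{for all }\alpha\}$. The quotient space of $[\mathfrak f;\mathbf M]$ by $\mathbf M'$ is the set of inner TOTEMplices $[\mathfrak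 p;\mathbf M']$ with $\mathfrak p\in[\mathfrak f;\mathbf M]$. The $I$-divergence is $D(\mathfrak p\|\mathfrak r)=\sum_{e\in\mathcal D_\star}p_e\log\frac{p_e}{r_e}$ with $0\log0=0$. The $I$-projection of $\upsilon$ onto a TOTEMplex is the unique minimizer of $\mathfrak p\mapsto D(\mathfrak p\|\upsilon)$ over it. *)

(* Defs.v *)
From HB Require Import structures.
From mathcomp Require Import all_boot all_order all_algebra.
From mathcomp Require Import all_classical all_reals all_analysis.
From mathcomp Require Import measurable_realfun.

Set Implicit Arguments.
Unset Strict Implicit.
Unset Printing Implicit Defensive.

Import Order.TTheory GRing.Theory Num.Theory.
Import numFieldNormedType.Exports.

Local Open Scope classical_set_scope.
Local Open Scope ring_scope.

(** Row vectors as a measurable space, with the sigma-algebra generated by the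
    coordinates (as for [n.-tuple R] in MathComp-Analysis). *)

Definition measure_rV_display : measure_display.
Proof. exact. Qed.

Section measurable_rV.
Context {R : realType} {n : nat}.

Let coor (j : 'I_n) (v : 'rV[R]_n) : R := v 0 j.

Let rV_set0 : g_sigma_preimage coor set0.
Proof. exact: sigma_algebra0. Qed.

Let rV_setC A : g_sigma_preimage coor A -> g_sigma_preimage coor (~` A).
Proof. exact: sigma_algebraC. Qed.

Let rV_bigcup (F : _^nat) : (forall i, g_sigma_preimage coor (F i)) ->
  g_sigma_preimage coor (\bigcup_i (F i)).
Proof. exact: sigma_algebra_bigcup. Qed.

HB.instance Definition _ := @isMeasurable.Build measure_rV_display
  'rV[R]_n (g_sigma_preimage coor) rV_set0 rV_setC rV_bigcup.

End measurable_rV.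

Section rV_measurability.
Context {R : realType}.

Lemma measurable_rV_coor n (j : 'I_n) :
  measurable_fun [set: 'rV[R]_n] (fun v : 'rV[R]_n => v 0 j).
Proof.
move=> _ Y mY; rewrite setTI; apply: sub_sigma_algebra => /=.
rewrite -bigcup_seq/=; exists j => /=; first by rewrite mem_index_enum.
by exists Y => //; rewrite setTI.
Qed.

Lemma measurable_fun_rVP d (T : measurableType d) n (f : T -> 'rV[R]_n) :
  measurable_fun [set: T] f <->
  forall j, measurable_fun [set: T] (fun x => f x 0 j).
Proof.
split=> [mf j|mf].
  exact: (measurableT_comp (measurable_rV_coor j) mf).
move=> _ /= A mA; rewrite setTI.
have : <<s \big[setU/set0]_(j < n) preimage_set_system setT
   (fun v : 'rV[R]_n => v 0 j) measurable >> `<=`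
   [set B | measurable (f @^-1` B)].
  apply: smallest_sub.
    split => /=.
    - by rewrite preimage_set0.
    - by move=> B mB; rewrite setTD preimage_setC; exact: measurableC.
    - by move=> F mF; rewrite preimage_bigcup; exact: bigcupT_measurable.
  move=> B; rewrite -bigcup_seq => -[j _ [C mC <-]] /=.
  by have := mf j measurableT C mC; rewrite !setTI.
exact.
Qed.

Definition rV_cons n (xv : measurableTypeR R * 'rV[R]_n) : 'rV[R]_n.+1 :=
  row_mx (xv.1 : R)%:M xv.2.

Lemma rV_cons0 n (xv : measurableTypeR R * 'rV[R]_n) :
  rV_cons xv 0 0 = xv.1.
Proof.
rewrite mxE; case: splitP => // j _.
by rewrite mxE !ord1 eqxx mulr1n.
Qed.

Lemma rV_consS n (xv : measurableTypeR R * 'rV[R]_n) (j : 'I_n) :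
  rV_cons xv 0 (lift 0 j) = xv.2 0 j.
Proof.
rewrite mxE; case: splitP => [i /= ji|i /= ji].
  by have := ltn_ord i; rewrite -ji.
by congr (_ _ _); apply/val_inj => /=; case: ji.
Qed.

Lemma measurable_rV_cons n : measurable_fun setT (@rV_cons n).
Proof.
apply/measurable_fun_rVP => j.
case: (unliftP 0 j) => [i ->|->].
  under eq_fun do rewrite rV_consS.
  exact: (measurableT_comp (measurable_rV_coor i) measurable_snd).
under eq_fun do rewrite rV_cons0.
exact: measurable_fst.
Qed.

HB.instance Definition _ n :=
  isMeasurableFun.Build _ _ _ _ (@rV_cons n) (@measurable_rV_cons n).

Definition rV_uncons n (v : 'rV[R]_n.+1) : measurableTypeR R * 'rV[R]_n :=
  (v 0 0, \row_j v 0 (lift 0 j)).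

Lemma rV_uncons_consK n : cancel (@rV_cons n) (@rV_uncons n).
Proof.
move=> xv; rewrite /rV_uncons rV_cons0 [RHS]surjective_pairing; congr pair.
by apply/rowP => j; rewrite mxE rV_consS.
Qed.

Lemma measurable_rV_uncons n : measurable_fun setT (@rV_uncons n).
Proof.
apply/measurable_fun_pairP; split; first exact: (measurable_rV_coor 0).
apply/measurable_fun_rVP => j /=.
under eq_fun do rewrite mxE.
exact: measurable_rV_coor.
Qed.

End rV_measurability.

Section rV_power_measure.
Context {R : realType}.
Variable mu : {sigma_finite_measure set (measurableTypeR R) -> \bar R}.

Definition rV_cons_measure n (nu : {sigma_finite_measure set 'rV[R]_n -> \bar R})
  : set 'rV[R]_n.+1 -> \bar R := pushforward (mu \x nu)%E (@rV_cons R n).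

Section step.
Variables (n : nat) (nu : {sigma_finite_measure set 'rV[R]_n -> \bar R}).

Let rV_cons_measure0 : rV_cons_measure nu set0 = 0%E.
Proof. exact: measure0. Qed.

Let rV_cons_measure_ge0 A : (0 <= rV_cons_measure nu A)%E.
Proof. exact: measure_ge0. Qed.

Let rV_cons_measure_sigma_additive : semi_sigma_additive (rV_cons_measure nu).
Proof. exact: measure_semi_sigma_additive. Qed.

HB.instance Definition _ := isMeasure.Build _ _ _ (rV_cons_measure nu)
  rV_cons_measure0 rV_cons_measure_ge0 rV_cons_measure_sigma_additive.

Lemma rV_cons_measureX (A : set (measurableTypeR R)) (B : set 'rV[R]_n) :
  measurable A -> measurable B ->
  rV_cons_measure nu (@rV_uncons R n @^-1` (A `*` B)) = (mu A * nu B)%E.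
Proof.
move=> mA mB; rewrite /rV_cons_measure /pushforward -comp_preimage.
rewrite (_ : _ @^-1` _ = A `*` B); first exact: product_measure1E.
by apply/funext => xv; exact: congr1 (rV_uncons_consK xv).
Qed.

Let rV_cons_sigma_finite : sigma_finite setT (rV_cons_measure nu).
Proof.
have /sigma_finiteP[F [FT ndF Foo]] := sigma_finiteT mu.
have /sigma_finiteP[G [GT ndG Goo]] := sigma_finiteT nu.
exists (fun k => @rV_uncons R n @^-1` (F k `*` G k)).
  apply/esym; rewrite -subTset => v _.
  have [i _ Fi] : (\bigcup_i F i) (rV_uncons v).1 by rewrite -FT.
  have [j _ Gj] : (\bigcup_i G i) (rV_uncons v).2 by rewrite -GT.
  exists (maxn i j) => //; split.
    by move: Fi; exact/subsetPset/ndF/leq_maxl.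
  by move: Gj; exact/subsetPset/ndG/leq_maxr.
move=> k; have [mF Fk] := Foo k; have [mG Gk] := Goo k; split.
  rewrite -[X in measurable X]setTI.
  by apply: measurable_rV_uncons => //; exact: measurableX.
by rewrite rV_cons_measureX// lte_mul_pinfty// ge0_fin_numE.
Qed.

HB.instance Definition _ := Measure_isSigmaFinite.Build _ _ _
  (rV_cons_measure nu) rV_cons_sigma_finite.
End step.

Fixpoint rV_power n : {sigma_finite_measure set 'rV[R]_n -> \bar R} :=
  match n with
  | 0 => \d_(0 : 'rV[R]_0)
  | m.+1 => rV_cons_measure (rV_power m)
  end.

Local Open Scope ereal_scope.

Lemma rV_power_box n (A : 'I_n -> set (measurableTypeR R)) :
  (forall j, measurable (A j)) ->
  rV_power n [set v | forall j, A j (v 0%R j)] = \prod_(j < n) mu (A j).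
Proof.
elim: n A => [|n IH] A mA.
  rewrite big_ord0 /= diracE mem_set//.
  by case.
have mB : measurable [set v : 'rV[R]_n | forall j, A (lift ord0 j) (v 0%R j)].
  rewrite (_ : [set v | _] = \bigcap_(j in [set: 'I_n])
      (fun v : 'rV[R]_n => v 0%R j) @^-1` A (lift ord0 j)); last first.
    by apply/seteqP; split=> v /= Av j; [move=> _; exact: Av|exact: Av].
  apply: fin_bigcap_measurable => // j _.
  rewrite -[X in measurable X]setTI.
  by apply: measurable_rV_coor => //; exact: mA.
rewrite big_ord_recl -(IH (A \o lift ord0)); last by move=> j; exact: mA.
rewrite -rV_cons_measureX//.
congr (_ _); apply/seteqP; split=> v /= => [Av|[A0 AS] j].
  by split=> [|j]; rewrite ?mxE; exact: Av.
case: (unliftP ord0 j) => [i ->|->//].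
by have := AS i; rewrite mxE.
Qed.

End rV_power_measure.

Definition lebesgue_rV (R : realType) (n : nat) :
  {sigma_finite_measure set 'rV[R]_n -> \bar R} :=
  rV_power (@lebesgue_measure R) n.

Section affine_lebesgue.
Context {R : realType}.

Definition affine_param m n (q : 'rV[R]_n) (V : 'M[R]_(m, n))
  (x : 'rV[R]_(\rank V)) : 'rV[R]_n := q + x *m row_base V.

Lemma measurable_affine_param m n (q : 'rV[R]_n) (V : 'M[R]_(m, n)) :
  measurable_fun setT (affine_param q (V := V)).
Proof.
apply/measurable_fun_rVP => j.
under eq_fun do rewrite !mxE.
apply: measurable_funD => //; apply: measurable_sum => i.
by apply: measurable_funM => //; exact: measurable_rV_coor.
Qed.

HB.instance Definition _ m n (q : 'rV[R]_n) (V : 'M[R]_(m, n)) :=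
  isMeasurableFun.Build _ _ _ _ (affine_param q (V := V))
    (@measurable_affine_param m n q V).

Section measure.
Context {m n : nat}.
Variables (q : 'rV[R]_n) (V : 'M[R]_(m, n)).

Definition affine_image : set 'rV[R]_n -> \bar R :=
  pushforward (lebesgue_rV R (\rank V)) (affine_param q (V := V)).

Let affine_image0 : affine_image set0 = 0%E.
Proof. exact: measure0. Qed.

Let affine_image_ge0 A : (0 <= affine_image A)%E.
Proof. exact: measure_ge0. Qed.

Let affine_image_sigma_additive : semi_sigma_additive affine_image.
Proof. exact: measure_semi_sigma_additive. Qed.

HB.instance Definition _ := isMeasure.Build _ _ _ affine_image
  affine_image0 affine_image_ge0 affine_image_sigma_additive.

(** Lebesgue measure on the affine space [q + V], where [V] is the row space of
    a matrix: the Gram determinant of the basis used for the coordinates makes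
    it the measure given by the Euclidean structure. *)
Definition lebesgue_affine : {measure set 'rV[R]_n -> \bar R} :=
  mscale (NngNum (sqrtr_ge0 (\det (row_base V *m (row_base V)^T))))
    affine_image.

End measure.

End affine_lebesgue.

(** The chi-squared distribution is the law of the sum of the squares of [k]
    independent standard Gaussian variables. *)

Section chi_squared.
Context {R : realType}.
Variable k : nat.

Definition sum_squares (x : 'rV[R]_k) : R := \sum_(j < k) x 0 j ^+ 2.

Let measurable_sum_squares : measurable_fun setT sum_squares.
Proof.
apply: measurable_sum => j; apply: measurable_funX.
exact: measurable_rV_coor.
Qed.

HB.instance Definition _ :=
  isMeasurableFun.Build _ _ _ _ sum_squares measurable_sum_squares.

Definition chi_squared : set R -> \bar R :=
  pushforward (rV_power (@normal_prob R 0 1) k) sum_squares.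

Let chi_squared0 : chi_squared set0 = 0%E.
Proof. exact: measure0. Qed.

Let chi_squared_ge0 A : (0 <= chi_squared A)%E.
Proof. exact: measure_ge0. Qed.

Let chi_squared_sigma_additive : semi_sigma_additive chi_squared.
Proof. exact: measure_semi_sigma_additive. Qed.

HB.instance Definition _ := isMeasure.Build _ _ _ chi_squared
  chi_squared0 chi_squared_ge0 chi_squared_sigma_additive.

Let chi_squared_setT : chi_squared [set: R] = 1%E.
Proof.
rewrite /chi_squared /pushforward preimage_setT.
have := @rV_power_box R (@normal_prob R 0 1) k (fun=> setT) (fun=> measurableT).
rewrite (_ : [set v | _] = setT); last by apply/seteqP; split.
move=> ->; rewrite big1// => j _.
exact: (@probability_setT _ _ _ (@normal_prob R 0 1)).
Qed.

HB.instance Definition _ :=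
  Measure_isProbability.Build _ _ _ chi_squared chi_squared_setT.

End chi_squared.

(** Pointwise convergence of the cumulative distribution functions at the
    continuity points of the limit one; the random variables may live on
    different probability spaces. *)
Definition cvg_in_distribution (R : realType) (d : nat -> measure_display)
    (Omega : forall N, measurableType (d N))
    (P : forall N, probability (Omega N) R)
    (X : forall N, {RV (P N) >-> R}) (mu : probability R R) : Prop :=
  forall t : R, {for t, continuous (fun s : R => fine (mu `]-oo, s]%classic))} ->
    cdf (X N) t @[N --> \oo] --> mu `]-oo, t]%classic.

Definition has_density_proportional_to (R : realType) n d
    (Omega : measurableType d) (P : probability Omega R)
    (X : {RV P >-> 'rV[R]_n}) (lambda : set 'rV[R]_n -> \bar R)
    (A : set 'rV[R]_n) (g : 'rV[R]_n -> R) : Prop :=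
  (forall w, A (X w)) /\
  exists2 c : R, 0 < c & forall B : set 'rV[R]_n, measurable B ->
    distribution P X B = (\int[lambda]_(x in B `&` A) (c * g x)%:E)%E.

Definition is_distribution (R : realType) (T : finType) (g : T -> R) : Prop :=
  (forall e, 0 <= g e) /\ \sum_e g e = 1.

(** Functions on the set [Dstar] of admissible configurations are row vectors
    indexed by the enumeration [enum_val : 'I_#|Dstar| -> T] of [Dstar]. *)
Definition on_admissible (R : realType) (T : finType) (Dstar : {set T})
  (g : T -> R) : 'rV[R]_#|Dstar| := \row_j g (enum_val j).

Section totem.
Context {R : realType} {n : nat}.
Implicit Types (p r g : 'rV[R]_n) (A : set 'rV[R]_n).

Definition simplex : set 'rV[R]_n :=
  [set p | (forall e, 0 <= p 0 e) /\ \sum_e p 0 e = 1].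

(** The convention [0 log 0 = 0] holds because [0 * _ = 0]. As [ln 0 = 0] and
    [x / 0 = 0], the value is not the usual one ([+oo]) when [r] vanishes at a
    point where [p] does not, so this is meant for positive [r] only. *)
Definition Idiv p r : R := \sum_e p 0 e * ln (p 0 e / r 0 e).

(** The rows of [M] are the functions [m_1, ..., m_D]; the last condition says
    that the constant function [1] is in their linear span. *)
Definition irreducible_vector_operator D (M : 'M[R]_(D, n)) : Prop :=
  row_free M /\ ((const_mx 1 : 'rV[R]_n) <= M)%MS.

Definition vop_implies D' D (M' : 'M[R]_(D', n)) (M : 'M[R]_(D, n)) : Prop :=
  exists2 S : 'M[R]_(D, D'), \rank S = D & M = S *m M'.

Definition ker_vop D (M : 'M[R]_(D, n)) : 'M[R]_n := kermx M^T.

Lemma ker_vopP D (M : 'M[R]_(D, n)) (u : 'rV[R]_n) :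
  reflect (forall a, \sum_e M a e * u 0 e = 0) (u <= ker_vop M)%MS.
Proof.
apply: (iffP sub_kermxP) => [uM a|uM].
  move/rowP : uM => /(_ a); rewrite !mxE; apply: etrans.
  by apply: eq_bigr => e _; rewrite mxE mulrC.
apply/rowP => a; rewrite !mxE; apply: etrans (uM a).
by apply: eq_bigr => e _; rewrite mxE mulrC.
Qed.

Definition totemplex D (g : 'rV[R]_n) (M : 'M[R]_(D, n)) : set 'rV[R]_n :=
  [set p | simplex p /\
    forall a, \sum_e M a e * p 0 e = \sum_e M a e * g 0 e].

(** Uniqueness of the minimizer on a convex set is a consequence of the strict
    convexity of the I-divergence. *)
Definition is_Iprojection r A q : Prop :=
  A q /\ forall p, A p -> Idiv q r <= Idiv p r.

End totem.

(* Main.v *)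
From HB Require Import structures.
Require Import Defs.
From mathcomp Require Import all_boot all_order all_algebra.
From mathcomp Require Import all_classical all_reals all_analysis.
From mathcomp Require Import measurable_realfun.
From mathcomp Require Import ring lra zify.

(** Because [q] has positive entries, it is interior to the ambient polytope
    relative to its affine span, so that the minimality of [q] yields an exact
    Pythagorean identity [Idiv p ups = Idiv p q + Idiv q ups] on this polytope
    ([Iprojection_pythagoras]). Hence the law of [p N] has a density
    proportional to [exp (- N * Idiv x q)], and the inner projection [q' x] also
    minimizes [Idiv _ q] over its fibre ([inner_Iprojection]): the statistic is
    [2 * N] times the least value of [Idiv _ q] on the fibre of the random point.

    Near [q], [Idiv _ q] is half of the quadratic form [pearson], that is, of the
    Fisher metric at [q] ([Idiv_taylor]). Choose a basis of [ker_vop M] that is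
    orthonormal for this metric and starts with a basis of [ker_vop M'], and write
    a point of the polytope as [q + y / sqrt N] with [y = (a, b)] in this basis.
    For a fixed [y], the density tends, up to
    normalization, to [exp (- |y| ^+ 2 / 2)] ([cvg_weight]). Moving inside the fibre of [M'] changes
    [a] and leaves [b] alone, so the statistic tends to [|b| ^+ 2]
    ([cvg_inner_divergence]): the point with [a = 0] bounds it from above, and
    Bessel's inequality bounds it from below. As [b] has [D' - D] coordinates,
    its squared length is chi-squared when [y] is a standard Gaussian vector.

    To pass to the limit in the integrals, [Idiv _ q] is bounded below by a
    multiple of the quadratic form on the whole simplex ([Idiv_ge_pearson]), so a
    Gaussian dominates all the rescaled densities. The distribution function of
    the statistic is a ratio of two such integrals, whatever the normalizing
    constants are ([dominated_ratio_cvg]); the boundary [|b| ^+ 2 = t] of the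
    limit event is negligible at a continuity point [t].

    Two points of measure theory remain. The density is given with respect to
    Lebesgue measure in an unspecified basis; another basis only multiplies this
    measure by a constant ([lebesgue_affineE]), by the uniqueness of
    translation-invariant measures ([translation_invariant_unique]). And [q'] is
    an arbitrary choice of minimizers, but the sublevel sets of the least
    divergence on a fibre are projections of compact sets, hence measurable
    ([measurable_inner_sublevel]). *)

Set Implicit Arguments.
Unset Strict Implicit.
Unset Printing Implicit Defensive.

Import Order.TTheory GRing.Theory Num.Theory.
Import numFieldNormedType.Exports.

Local Open Scope classical_set_scope.
Local Open Scope ring_scope.

(** * Orthonormal bases for a symmetric positive definite form *)

Section orthonormal_bases.
Context {R : rcfType} {n : nat}.
Variable G : 'M[R]_n.
Hypothesis symG : G^T = G.
Hypothesis posG : forall u : 'rV[R]_n, u != 0 -> 0 < (u *m G *m u^T) 0 0.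

Definition orthonormal_rows r (B : 'M[R]_(r, n)) : Prop := B *m G *m B^T = 1%:M.

Definition orthocomplement r (B : 'M[R]_(r, n)) : 'M[R]_n := kermx (G *m B^T).

Lemma orthonormal_row_free r (B : 'M[R]_(r, n)) : orthonormal_rows B -> row_free B.
Proof. by move=> oB; apply/row_freeP; exists (G *m B^T); rewrite mulmxA. Qed.

Lemma sub_orthocomplement r (B : 'M[R]_(r, n)) m (u : 'M[R]_(m, n)) :
  (u <= orthocomplement B)%MS <-> u *m G *m B^T = 0.
Proof. by rewrite -mulmxA; split=> [/sub_kermxP|?]//; apply/sub_kermxP. Qed.

Lemma orthogonal_rows_sym r s (A : 'M[R]_(r, n)) (B : 'M[R]_(s, n)) :
  A *m G *m B^T = 0 -> B *m G *m A^T = 0.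
Proof.
by move=> AB0; apply: trmx_inj; rewrite !trmx_mul trmxK symG mulmxA AB0 trmx0.
Qed.

Section decomposition.
Variables (r m : nat) (B : 'M[R]_(r, n)) (V : 'M[R]_(m, n)).
Hypotheses (oB : orthonormal_rows B) (BV : (B <= V)%MS).

(** Subtracting from a vector its components along [B] leaves a vector of [V]
    orthogonal to [B]. *)
Lemma orthogonal_decomposition :
  (B + (V :&: orthocomplement B) :=: V)%MS.
Proof.
apply/eqmxP/andP; split; first by rewrite addsmx_sub BV capmxSl.
pose W := V *m G *m B^T *m B.
have WB : (W <= B)%MS by exact: submxMl.
rewrite -[X in (X <= _)%MS](subrKC W) addmx_sub_adds// sub_capmx.
apply/andP; split.
  by rewrite addmx_sub// -scaleN1r scalemx_sub// (submx_trans WB).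
by apply/sub_orthocomplement; rewrite !mulmxBl -!mulmxA (mulmxA B) oB mulmx1 subrr.
Qed.

Lemma mxrank_orthocomplement : \rank (V :&: orthocomplement B)%MS = (\rank V - r)%N.
Proof.
have dBO : (B :&: (V :&: orthocomplement B) = 0)%MS.
  apply/eqP; rewrite -submx0; apply/rV_subP => u.
  rewrite !sub_capmx => /and3P[/submxP[a ->] _ /sub_orthocomplement].
  by rewrite -!mulmxA (mulmxA B) oB mulmx1 => ->; rewrite mul0mx sub0mx.
rewrite -orthogonal_decomposition mxrank_disjoint_sum//.
by have /eqP -> := orthonormal_row_free oB; rewrite addKn.
Qed.

End decomposition.

Lemma orthonormal_col_mx r s (A : 'M[R]_(r, n)) (B : 'M[R]_(s, n)) :
  orthonormal_rows A -> orthonormal_rows B -> B *m G *m A^T = 0 ->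
  orthonormal_rows (col_mx A B).
Proof.
move=> oA oB BA0.
rewrite /orthonormal_rows mul_col_mx tr_col_mx mul_col_row oA oB BA0.
by rewrite (orthogonal_rows_sym BA0) -scalar_mx_block.
Qed.

(** Gram-Schmidt by induction on the dimension: normalize one nonzero vector of [V],
    then continue in its orthogonal complement within [V]. *)
Lemma orthonormal_basis t m (V : 'M[R]_(m, n)) :
  \rank V = t -> exists2 B : 'M[R]_(t, n), (B :=: V)%MS & orthonormal_rows B.
Proof.
elim: t m V => [|t IH] m V rV.
  exists 0; last by apply/matrixP=> -[].
  move/eqP: rV; rewrite mxrank_eq0 => /eqP ->.
  by apply/eqmxP; rewrite !sub0mx.
have V0 : V != 0 by rewrite -mxrank_eq0 rV.
set v := nz_row V; have v0 : v != 0 by rewrite nz_row_eq0.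
have := posG v0; set c := (v *m G *m v^T) 0 0 => c0.
pose b := (Num.sqrt c)^-1 *: v.
have bV : (b <= V)%MS by rewrite scalemx_sub ?nz_row_sub.
have ob : orthonormal_rows b.
  apply/matrixP => i j; rewrite !ord1 /b linearZ/= -!scalemxAl -scalemxAr.
  rewrite scalerA -invfM -expr2 sqr_sqrtr ?ltW// mxE -/c mulVf ?gt_eqF//.
  by rewrite mxE.
have [|B BV oB] := IH _ (V :&: orthocomplement b)%MS.
  by rewrite mxrank_orthocomplement// rV subn1.
have oBb : B *m G *m b^T = 0.
  by apply/sub_orthocomplement; rewrite BV capmxSr.
exists (col_mx b B); last exact: (orthonormal_col_mx ob oB oBb).
apply: eqmx_trans (eqmx_sym (addsmxE b B)) _.
apply: eqmx_trans (adds_eqmx (eqmx_refl b) BV) _.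
exact: orthogonal_decomposition.
Qed.

Lemma orthonormal_basis_extension k r m (A : 'M[R]_(r, n)) (V : 'M[R]_(m, n)) :
    orthonormal_rows A -> (A <= V)%MS -> k = (\rank V - r)%N ->
  exists2 B : 'M[R]_(k, n), (col_mx A B :=: V)%MS & orthonormal_rows (col_mx A B).
Proof.
move=> oA AV ->.
have [B BV oB] := orthonormal_basis (mxrank_orthocomplement oA AV).
have oBA : B *m G *m A^T = 0.
  by apply/sub_orthocomplement; rewrite BV capmxSr.
exists B; last exact: orthonormal_col_mx.
apply: eqmx_trans (eqmx_sym (addsmxE A B)) _.
apply: eqmx_trans (adds_eqmx (eqmx_refl A) BV) _.
exact: orthogonal_decomposition.
Qed.

End orthonormal_bases.

(** * Lebesgue measure on row vectors: translations and linear maps *)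

Section rV_measurable.
Context {R : realType}.

Lemma measurable_addrV n :
  measurable_fun setT (fun xy : 'rV[R]_n * 'rV[R]_n => xy.1 + xy.2).
Proof.
apply/measurable_fun_rVP => j; under eq_fun do rewrite mxE.
by apply: measurable_funD; apply: (measurableT_comp (measurable_rV_coor j)).
Qed.

Lemma measurable_mulmxr m n (L : 'M[R]_(m, n)) :
  measurable_fun setT (fun x : 'rV[R]_m => x *m L).
Proof.
apply/measurable_fun_rVP => j; under eq_fun do rewrite mxE.
apply: measurable_sum => i; apply: measurable_funM => //.
exact: measurable_rV_coor.
Qed.

Lemma measurable_opprV n : measurable_fun setT (fun x : 'rV[R]_n => - x).
Proof.
apply/measurable_fun_rVP => j; under eq_fun do rewrite mxE.
by apply: measurableT_comp => //; exact: measurable_rV_coor.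
Qed.

Lemma measurable_preimage d1 d2 (T1 : measurableType d1) (T2 : measurableType d2)
    (f : T1 -> T2) (A : set T2) :
  measurable_fun setT f -> measurable A -> measurable (f @^-1` A).
Proof. by move=> mf mA; rewrite -[X in measurable X]setTI; exact: mf. Qed.

Lemma measurable_rV_box n (A : 'I_n -> set (measurableTypeR R)) :
  (forall j, measurable (A j)) ->
  measurable [set v : 'rV[R]_n | forall j, A j (v 0 j)].
Proof.
move=> mA; rewrite (_ : [set v | _] = \bigcap_(j in [set: 'I_n])
    (fun v : 'rV[R]_n => v 0 j) @^-1` A j); last first.
  by apply/seteqP; split=> v /= Av j; [move=> _; exact: Av|exact: Av].
apply: fin_bigcap_measurable => // j _.
exact: measurable_preimage (measurable_rV_coor j) (mA j).
Qed.

End rV_measurable.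

Section translation_invariance.
Context {R : realType}.
Local Open Scope ereal_scope.

Lemma lebesgue_measure_translate (a : R) (A : set (measurableTypeR R)) :
  measurable A ->
  lebesgue_measure ((fun x : measurableTypeR R => (x + a)%R) @^-1` A) =
  lebesgue_measure A.
Proof.
move=> mA.
have mf : measurable_fun setT
    (fun x : measurableTypeR R => (x + a)%R : measurableTypeR R).
  exact: measurable_funD.
pose f : {mfun measurableTypeR R >-> measurableTypeR R} :=
  HB.pack (fun x : measurableTypeR R => (x + a)%R : measurableTypeR R)
    (isMeasurableFun.Build _ _ _ _ _ mf).
apply/esym; apply: (@lebesgue_measure_unique _ (pushforward lebesgue_measure f)).
  move=> X /ocitvP[->|[[x y] xy ->]]; first by rewrite !measure0.
  rewrite /= /pushforward (_ : _ @^-1` _ = `](x - a)%R, (y - a)%R]%classic).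
    rewrite !lebesgue_measure_itv/= !lte_fin ltrD2r; case: ifP => // _.
    by rewrite -!EFinD; congr EFin; ring.
  by apply/seteqP; split => z /=; rewrite !in_itv/= => /andP[? ?]; lra.
exact: mA.
Qed.

(** By induction on the dimension: a translation moves the slices of a set by its
    first coordinate and translates each slice by the others. *)
Lemma lebesgue_rV_translate n (a : 'rV[R]_n) (A : set 'rV[R]_n) :
  measurable A ->
  lebesgue_rV R n ((fun x => (x + a)%R) @^-1` A) = lebesgue_rV R n A.
Proof.
elim: n a A => [|n IH] a A mA.
  congr (lebesgue_rV R 0 _); apply/funext => x.
  by rewrite /preimage/=; congr A; apply/rowP; case.
pose a0 : R := a 0%R 0%R; pose a' : 'rV[R]_n := (\row_j a 0%R (lift ord0 j))%R.
have mA' : measurable (@rV_cons R n @^-1` A).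
  exact: measurable_preimage (measurable_rV_cons (n := n)) mA.
rewrite /lebesgue_rV/= /rV_cons_measure /pushforward /=.
set mu := lebesgue_measure; set nu := rV_power mu n.
have E x : xsection (@rV_cons R n @^-1` ((fun x => (x + a)%R) @^-1` A)) x =
    (fun v => v + a')%R @^-1` xsection (@rV_cons R n @^-1` A) (x + a0)%R.
  apply/seteqP; split => v; rewrite /xsection/= !inE/=;
  rewrite (_ : rV_cons (x, v) + a = rV_cons (x + a0, v + a'))%R //;
  (apply/rowP => j; rewrite mxE; case: (unliftP ord0 j) => [i ->|->];
    by rewrite ?rV_consS ?rV_cons0 // !mxE).
rewrite /product_measure1.
transitivity (\int[mu]_x ((nu \o xsection (@rV_cons R n @^-1` A)) \o
   (fun x : measurableTypeR R => x + a0)%R) x).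
  apply: eq_integral => x _; rewrite [LHS]/= [xsection _ _]E.
  by apply: IH; exact: measurable_xsection.
have mf : measurable_fun setT
    (fun x : measurableTypeR R => (x + a0)%R : measurableTypeR R).
  exact: measurable_funD.
rewrite -(@ge0_integral_pushforward _ _ _ _ _ _ mf mu setT) //; last first.
  exact: measurable_fun_xsection.
apply: eq_measure_integral => B mB _.
exact: lebesgue_measure_translate.
Qed.

End translation_invariance.

Section linear_image.
Context {R : realType}.
Local Open Scope ereal_scope.

Definition translation_invariant n (nu : set 'rV[R]_n -> \bar R) : Prop :=
  forall (a : 'rV[R]_n) (A : set 'rV[R]_n), measurable A ->
    nu ((fun x => (x + a)%R) @^-1` A) = nu A.

Lemma integral_if_mem d (T : measurableType d) (mu : {measure set T -> \bar R})
    (A : set T) (c : \bar R) :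
  measurable A -> 0 <= c -> \int[mu]_x (if x \in A then c else 0) = c * mu A.
Proof.
move=> mA c0; rewrite -integral_cst// [RHS]integral_mkcond.
by apply: eq_integral => x _; rewrite patchE.
Qed.

Lemma measurable_add_preimage n (A B : set 'rV[R]_n) :
  measurable A -> measurable B ->
  measurable [set xy : 'rV[R]_n * 'rV[R]_n | A xy.1 /\ B (xy.1 + xy.2)%R].
Proof.
move=> mA mB; apply: measurableI.
  exact: measurable_preimage measurable_fst mA.
exact: measurable_preimage (measurable_addrV (n := n)) mB.
Qed.

(** Both sides are the measure of the pairs [(x, y)] with [A x] and [B (x + y)],
    sliced along [x] or along [y]; in the second case the translation by [- y] turns
    the slice into the points [x] of [B] with [A (x - y)]. *)
Lemma translation_invariant_cross n
    (nu lambda : {sigma_finite_measure set 'rV[R]_n -> \bar R})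
    (A B : set 'rV[R]_n) :
  translation_invariant nu -> translation_invariant lambda ->
  measurable A -> measurable B ->
  nu A * lambda B = nu B * lambda (-%R @^-1` A).
Proof.
move=> tnu tla mA mB.
have mNA : measurable (-%R @^-1` A : set 'rV[R]_n).
  exact: measurable_preimage (measurable_opprV (n := n)) mA.
pose S1 := [set xy : 'rV[R]_n * 'rV[R]_n | A xy.1 /\ B (xy.1 + xy.2)%R].
pose S2 := [set xy : 'rV[R]_n * 'rV[R]_n | B xy.1 /\ (-%R @^-1` A) (xy.2 - xy.1)%R].
have mS1 : measurable S1 by exact: measurable_add_preimage.
have mS2 : measurable S2.
  apply: measurableI; first exact: measurable_preimage measurable_fst mB.
  have mf : measurable_fun setT (fun xy : 'rV[R]_n * 'rV[R]_n => (xy.2 - xy.1)%R).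
    apply/measurable_fun_rVP => j; under eq_fun do rewrite !mxE.
    by apply: measurable_funB; apply: (measurableT_comp (measurable_rV_coor j)).
  exact: measurable_preimage mf mNA.
have F1 := indic_fubini_tonelli nu lambda mS1.
have F2 := indic_fubini_tonelli nu lambda mS2.
rewrite !indic_fubini_tonelli_FE// !indic_fubini_tonelli_GE// in F1 F2.
have E1 : \int[nu]_x (lambda \o xsection S1) x = nu A * lambda B.
  rewrite muleC -integral_if_mem//; apply: eq_integral => x _ /=.
  case: ifPn; rewrite ?inE ?notin_setE => Ax.
    rewrite -(tla x B)//; congr (lambda _); apply/seteqP.
    split => y; rewrite /xsection/= inE/= addrC; first by case.
    by split.
  by rewrite -(measure0 lambda); congr (lambda _); apply/seteqP; split => y //;
    rewrite /xsection/= inE/=; case.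
have E2 : \int[nu]_x (lambda \o xsection S2) x = nu B * lambda (-%R @^-1` A).
  rewrite muleC -integral_if_mem//; apply: eq_integral => x _ /=.
  case: ifPn; rewrite ?inE ?notin_setE => Bx.
    rewrite -[RHS](tla (- x)%R)//; congr (lambda _); apply/seteqP.
    split => y; rewrite /xsection/= inE/=; first by case.
    by split.
  by rewrite -(measure0 lambda); congr (lambda _); apply/seteqP; split => y //;
    rewrite /xsection/= inE/=; case.
rewrite -E1 -E2 F1 F2; apply: eq_integral => y _ /=.
rewrite -(tnu y (ysection S2 y)); last exact: measurable_ysection.
congr (nu _); apply/seteqP; split => x; rewrite /ysection/= !inE/=.
  by case=> Ax Bxy; split=> //; rewrite /preimage/= opprB addrK.
by case=> Bxy; rewrite /preimage/= opprB addrK.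
Qed.

Definition cube n (r : R) : set 'rV[R]_n :=
  [set v | forall j, `[(- r)%R, r]%classic (v 0%R j)].
Arguments cube n r _ : clear implicits.

Lemma measurable_cube n r : measurable (cube n r).
Proof.
by apply: (@measurable_rV_box _ _ (fun=> `[(- r)%R, r]%classic)) => j.
Qed.

Lemma lebesgue_cube n r : (0 < r)%R ->
  lebesgue_rV R n (cube n r) = ((r *+ 2) ^+ n)%:E.
Proof.
move=> r0; rewrite /cube /lebesgue_rV.
rewrite (rV_power_box _ (A := fun=> `[(- r)%R, r]%classic))//.
rewrite (eq_bigr (fun=> (r *+ 2)%:E)); last first.
  move=> j _; rewrite [LHS]lebesgue_measure_itv/= lte_fin ifT; last lra.
  by rewrite -EFinD opprK mulr2n.
elim: n => [|n IH]; first by rewrite big_ord0 expr0.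
by rewrite big_ord_recl IH exprS EFinM.
Qed.

(** The case [nu = lebesgue_rV] of the previous identity, with [B] symmetric, so that
    [nu B] can be cancelled. *)
Lemma lebesgue_rV_opp n (A : set 'rV[R]_n) : measurable A ->
  lebesgue_rV R n (-%R @^-1` A) = lebesgue_rV R n A.
Proof.
move=> mA.
have := @translation_invariant_cross n (lebesgue_rV R n) (lebesgue_rV R n) A
  (cube n 1) (@lebesgue_rV_translate R n) (@lebesgue_rV_translate R n) mA
  (@measurable_cube n 1).
rewrite lebesgue_cube// muleC => /esym; rewrite muleC [RHS]muleC.
have c0 : (0 < (1 *+ 2) ^+ n :> R)%R by rewrite exprn_gt0.
move/(congr1 (fun x => ((1 *+ 2) ^+ n)^-1%:E * x)).
by rewrite ![_ * _%:E]muleC !muleA -!EFinM mulVf ?gt_eqF// !mul1e.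
Qed.

Lemma translation_invariant_unique n
    (nu : {sigma_finite_measure set 'rV[R]_n -> \bar R}) (A : set 'rV[R]_n) :
  translation_invariant nu -> measurable A ->
  lebesgue_rV R n A * nu (cube n 1) = nu A * (2 ^+ n)%:E.
Proof.
move=> tnu mA.
have := @translation_invariant_cross n nu (lebesgue_rV R n) A
  (cube n 1) tnu (@lebesgue_rV_translate R n) mA (@measurable_cube n 1).
by rewrite lebesgue_cube// lebesgue_rV_opp// => ->; rewrite muleC.
Qed.

End linear_image.
Arguments cube {R} n r _.

Section linear_change_of_variables.
Context {R : realType}.
Local Open Scope ereal_scope.

(** The factor is a crude bound of the operator norm of [L] for the sup norm. *)
Lemma cube_mulmx m n (L : 'M[R]_(m, n)) (r : R) : (0 <= r)%R ->
  cube m r `<=` (fun x => (x *m L)%R) @^-1` cube n (r * (1 + \sum_i \sum_j `|L i j|)%R).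
Proof.
move=> r0 x xr j /=; rewrite in_itv/= -ler_norml mxE.
apply: (le_trans (ler_norm_sum _ _ _)).
apply: (@le_trans _ _ (\sum_i r * `|L i j|)%R).
  apply: ler_sum => i _; rewrite normrM ler_wpM2r//.
  by have := xr i; rewrite /= in_itv/= -ler_norml.
rewrite -mulr_sumr ler_wpM2l// -[leLHS]add0r lerD// ler_sum// => i _.
by rewrite (bigD1 j)//= lerDl sumr_ge0.
Qed.

Section image.
Variables (n : nat) (L : 'M[R]_n).
Hypothesis uL : L \in unitmx.

Let mL := measurable_mulmxr L.

Let nu : set 'rV[R]_n -> \bar R :=
  pushforward (lebesgue_rV R n) (fun x => x *m L)%R.

HB.instance Definition _ := Measure.copy nu
  (measure_function_pushforward__canonical__measure_function_Measure
    (lebesgue_rV R n) mL).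

Let nu_sigma_finite : sigma_finite setT nu.
Proof.
exists (fun k => (fun x => (x *m invmx L)%R) @^-1` cube n k.+1%:R).
  apply/esym; rewrite -subTset => v _.
  pose s := (\sum_j `|(v *m invmx L) 0 j|)%R.
  exists (Num.truncn s) => //= j; rewrite /= in_itv/= -ler_norml.
  apply: (@le_trans _ _ s); first by rewrite /s (bigD1 j)//= lerDl sumr_ge0.
  exact/ltW/truncnS_gt.
move=> k; split.
  exact: measurable_preimage (measurable_mulmxr _) (measurable_cube _).
rewrite /nu/= /pushforward -comp_preimage.
rewrite (_ : _ \o _ = id); first by rewrite preimage_id lebesgue_cube ?ltry.
by apply/funext => x /=; rewrite -mulmxA mulmxV// mulmx1.
Qed.

HB.instance Definition _ := Measure_isSigmaFinite.Build _ _ _ nu nu_sigma_finite.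

(** The image of Lebesgue measure by an invertible map is translation invariant. It is
    positive and finite on the unit cube, which contains the image of a small cube and
    is contained in the image of a large one. *)
Lemma lebesgue_rV_mulmx : exists2 c : R, (0 < c)%R &
  forall A, measurable A ->
    lebesgue_rV R n ((fun x => (x *m L)%R) @^-1` A) = c%:E * lebesgue_rV R n A.
Proof.
have tnu : translation_invariant nu.
  move=> a A mA; rewrite /nu /pushforward.
  rewrite -(lebesgue_rV_translate (a *m invmx L)%R (measurable_preimage mL mA)).
  congr (lebesgue_rV R n _); apply/funext => x.
  by rewrite /preimage/= mulmxDl -mulmxA mulVmx// mulmx1.
have nu_lt : nu (cube n 1) < +oo.
  pose s := (1 * (1 + \sum_i \sum_j `|invmx L i j|))%R.
  have s0 : (0 < s)%R.
    by rewrite /s mul1r ltr_wpDr// sumr_ge0// => i _; rewrite sumr_ge0.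
  apply: (@le_lt_trans _ _ (lebesgue_rV R n (cube n s))); last first.
    by rewrite lebesgue_cube// ltry.
  rewrite /nu /pushforward; apply: le_measure; rewrite ?inE.
  - exact: measurable_preimage mL (measurable_cube _).
  - exact: measurable_cube.
  - move=> x /(cube_mulmx (invmx L) ler01).
    by rewrite /preimage/= -mulmxA mulmxV// mulmx1.
have nu_gt : 0 < nu (cube n 1).
  pose s := (1 + \sum_i \sum_j `|L i j|)%R.
  have s0 : (0 < s)%R.
    by rewrite /s ltr_wpDr// sumr_ge0// => i _; rewrite sumr_ge0.
  apply: (@lt_le_trans _ _ (lebesgue_rV R n (cube n s^-1%R))).
    by rewrite lebesgue_cube ?invr_gt0// lte_fin exprn_gt0// pmulrn_lgt0// invr_gt0.
  rewrite /nu /pushforward; apply: le_measure; rewrite ?inE.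
  - exact: measurable_cube.
  - exact: measurable_preimage mL (measurable_cube _).
  - have sV0 : (0 <= s^-1)%R by rewrite invr_ge0 ltW.
    by move=> x /(cube_mulmx L sV0); rewrite mulVf// gt_eqF.
have nuE : nu (cube n 1) = (fine (nu (cube n 1)))%:E.
  by rewrite fineK// ge0_fin_numE// ltW.
exists (fine (nu (cube n 1)) / 2 ^+ n)%R.
  by rewrite divr_gt0 ?exprn_gt0// fine_gt0// nu_gt.
move=> A mA.
have : lebesgue_rV R n A * (fine (nu (cube n 1)))%:E = nu A * (2 ^+ n)%:E.
  by rewrite -nuE; exact: translation_invariant_unique.
move/(congr1 (fun x => x * (2 ^+ n)^-1%:E)).
rewrite -!muleA -!EFinM mulfV ?mule1; last by rewrite expf_neq0// pnatr_eq0.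
by move=> nuA; rewrite -[LHS]/(nu A) -nuA muleC.
Qed.

End image.
End linear_change_of_variables.

Section affine_parametrization.
Context {R : realType}.
Local Open Scope ereal_scope.

(** In an orthonormal basis [E] of the row space, [B = L *m E] with [L] invertible, and
    the Gram determinant is the square of [\det L]. *)
Lemma gram_gt0 m n (B : 'M[R]_(m, n)) :
  row_free B -> (0 < \det (B *m B^T))%R.
Proof.
move=> fB.
have sym1 : (1%:M : 'M[R]_n)^T%R = 1%:M by rewrite trmx1.
have pos1 (u : 'rV[R]_n) : u != 0%R -> (0 < (u *m 1%:M *m u^T) 0 0)%R.
  move=> u0; rewrite mulmx1 mxE; under eq_bigr do rewrite mxE -expr2.
  rewrite lt0r sumr_ge0 ?andbT; last by move=> i _; exact: sqr_ge0.
  apply: contra u0; rewrite psumr_eq0; last by move=> i _; exact: sqr_ge0.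
  move=> /allP u0; apply/eqP/rowP => j; rewrite mxE; apply/eqP.
  by have := u0 j (mem_index_enum _); rewrite /= sqrf_eq0.
have [E EB] := orthonormal_basis sym1 pos1 (eqP fB : \rank B = m).
rewrite /orthonormal_rows mulmx1 => oE.
have /submxP[L BL] : (B <= E)%MS by rewrite EB.
have uL : L \in unitmx.
  rewrite -row_free_unit /row_free eqn_leq rank_leq_row /=.
  by rewrite -{1}(eqP fB) BL mxrankM_maxl.
rewrite BL trmx_mul mulmxA -(mulmxA L) oE mulmx1 det_mulmx det_tr -expr2.
by rewrite exprn_even_gt0//= -unitfE -unitmxE.
Qed.

Lemma lebesgue_affineE m n t (q : 'rV[R]_n) (V : 'M[R]_(m, n))
    (B : 'M[R]_(t, n)) : row_free B -> (B :=: V)%MS ->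
  exists2 c : R, (0 < c)%R & forall S, measurable S ->
    lebesgue_affine q V S =
    c%:E * lebesgue_rV R t ((fun y => (q + y *m B)%R) @^-1` S).
Proof.
move=> fB BV.
pose g : R := Num.sqrt (\det (row_base V *m (row_base V)^T)).
have g0 : (0 < g)%R by rewrite sqrtr_gt0 gram_gt0// row_base_free.
suff [c c0 cE] : exists2 c : R, (0 < c)%R & forall S, measurable S ->
    lebesgue_rV R (\rank V) ((fun x => (q + x *m row_base V)%R) @^-1` S) =
    c%:E * lebesgue_rV R t ((fun y => (q + y *m B)%R) @^-1` S).
  exists (g * c)%R; first exact: mulr_gt0.
  move=> S mS; rewrite EFinM -muleA -cE//.
have tV : t = \rank V by rewrite -BV; apply/esym/eqP.
have := row_base_free V; have := eq_row_base V; move: (row_base V).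
rewrite -tV => E EV fE.
have /submxP[L EL] : (E <= B)%MS by rewrite EV BV.
have uL : L \in unitmx.
  rewrite -row_free_unit /row_free eqn_leq rank_leq_row /=.
  by rewrite -{1}(eqP fE) EL mxrankM_maxl.
have [c c0 cE] := lebesgue_rV_mulmx uL.
exists c => // S mS; rewrite -cE; last first.
  have mf : measurable_fun setT (fun y : 'rV[R]_t => q + y *m B)%R.
    apply/measurable_fun_rVP => j; under eq_fun do rewrite mxE.
    apply: measurable_funD => //.
    exact: (measurableT_comp (measurable_rV_coor j) (measurable_mulmxr B)).
  exact: measurable_preimage mf mS.
congr (lebesgue_rV R t _); apply/funext => x.
by rewrite /preimage/= EL mulmxA.
Qed.

End affine_parametrization.

(** * Gaussian measures on row vectors *)

Section product_density.
Local Open Scope ereal_scope.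
Context d1 d2 (T1 : measurableType d1) (T2 : measurableType d2) {R : realType}.
Variables (m1 n1 : {sigma_finite_measure set T1 -> \bar R}).
Variables (m2 n2 : {sigma_finite_measure set T2 -> \bar R}).
Variables (f1 : T1 -> R) (f2 : T2 -> R).
Hypotheses (mf1 : measurable_fun setT f1) (mf2 : measurable_fun setT f2).
Hypotheses (f1_ge0 : forall x, (0 <= f1 x)%R) (f2_ge0 : forall x, (0 <= f2 x)%R).
Hypothesis n1E : forall A, measurable A -> n1 A = \int[m1]_(x in A) (f1 x)%:E.
Hypothesis n2E : forall A, measurable A -> n2 A = \int[m2]_(x in A) (f2 x)%:E.

Let f (z : T1 * T2) : \bar R := (f1 z.1 * f2 z.2)%:E.

Let f_ge0 z : 0 <= f z.
Proof. by rewrite lee_fin mulr_ge0. Qed.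

Let mf : measurable_fun setT f.
Proof. by apply/measurable_EFinP; apply: measurable_funM; exact: measurableT_comp. Qed.

Let nu (S : set (T1 * T2)) : \bar R := \int[m1 \x m2]_(z in S) f z.

Let nu0 : nu set0 = 0. Proof. exact: integral_set0. Qed.

Let nu_ge0 A : 0 <= nu A. Proof. exact: integral_ge0. Qed.

Let nu_sigma_additive : semi_sigma_additive nu.
Proof. exact: semi_sigma_additive_nng_induced. Qed.

HB.instance Definition _ := isMeasure.Build _ _ _ nu nu0 nu_ge0 nu_sigma_additive.

(** The set function on the right is a measure that agrees with the product measure on
    rectangles. *)
Lemma product_measure_density (S : set (T1 * T2)) : measurable S ->
  (n1 \x n2) S = \int[m1 \x m2]_(z in S) (f1 z.1 * f2 z.2)%:E.
Proof.
apply: (product_measure_unique (m' := nu)) => A B mA mB.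
rewrite -[LHS]/(nu (A `*` B)) /nu integral_mkcond (fubini_tonelli1 (f \_ (A `*` B))); first last.
- by move=> z; rewrite patchE; case: ifP.
- apply/(measurable_restrictT _ (measurableX mA mB)); exact: measurable_funTS.
transitivity (\int[m1]_(x in A) (n2 B * (f1 x)%:E)).
  rewrite [RHS]integral_mkcond; apply: eq_integral => x _.
  rewrite /fubini_F patchE; case: ifPn => xA; last first.
    apply: integral0_eq => y _; rewrite patchE ifF//.
    by apply/negP; rewrite inE => -[/= Ax _]; move: xA; rewrite notin_setE.
  rewrite n2E// muleC -ge0_integralZl//; last 3 first.
  - exact/measurable_EFinP/measurable_funTS.
  - by move=> y _; rewrite lee_fin.
  - by rewrite lee_fin.
  rewrite [RHS]integral_mkcond; apply: eq_integral => y _.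
  rewrite !patchE; congr (if _ then _ else _).
  rewrite inE in xA; apply/idP/idP; rewrite !inE => yB; first by case: yB.
  by split.
rewrite ge0_integralZl//.
- by rewrite -n1E// muleC.
- exact/measurable_EFinP/measurable_funTS.
- by move=> y _; rewrite lee_fin.
Qed.

End product_density.

Section gaussian.
Context {R : realType}.
Local Open Scope ereal_scope.

Definition gauss_pdf (s : R) n (x : 'rV[R]_n) : R :=
  (normal_peak s ^+ n * expR (- (sum_squares x / (s ^+ 2 *+ 2))))%R.

Lemma gauss_pdf_ge0 s n (x : 'rV[R]_n) : (0 <= gauss_pdf s x)%R.
Proof. by rewrite mulr_ge0 ?exprn_ge0 ?normal_peak_ge0 ?expR_ge0. Qed.

Lemma measurable_sum_squares n : measurable_fun setT (@sum_squares R n).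
Proof.
by apply: measurable_sum => j; apply: measurable_funX; exact: measurable_rV_coor.
Qed.

Lemma measurable_gauss_pdf s n : measurable_fun setT (@gauss_pdf s n).
Proof.
apply: measurable_funM => //; apply: measurableT_comp => //.
by apply: measurableT_comp => //; apply: measurable_funM => //; exact: measurable_sum_squares.
Qed.

Lemma gauss_pdf_cons s n (z : measurableTypeR R * 'rV[R]_n) : (s != 0)%R ->
  gauss_pdf s (rV_cons z) = (normal_pdf 0 s z.1 * gauss_pdf s z.2)%R.
Proof.
move=> s0; rewrite normal_pdfE// /gauss_pdf exprS /normal_fun subr0.
rewrite mulrACA -expRD; congr (_ * expR _)%R.
have -> : sum_squares (rV_cons z) = (z.1 ^+ 2 + sum_squares z.2)%R.
  rewrite /sum_squares big_ord_recl rV_cons0; congr (_ + _)%R.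
  by apply: eq_bigr => j _; rewrite rV_consS.
by rewrite mulrDl opprD mulNr.
Qed.

Lemma rV_power_normal s n (A : set 'rV[R]_n) : (s != 0)%R -> measurable A ->
  rV_power (@normal_prob R 0 s) n A =
  \int[lebesgue_rV R n]_(x in A) (gauss_pdf s x)%:E.
Proof.
move=> s0; elim: n A => [|n IH] A mA.
  have m0 : measurable_fun A (fun x : 'rV[R]_0 => (gauss_pdf s x)%:E).
    by apply/measurable_EFinP/measurable_funTS; exact: measurable_gauss_pdf.
  rewrite /= integral_dirac// /gauss_pdf expr0 mul1r.
  have -> : sum_squares (0 : 'rV[R]_0)%R = 0%R by rewrite /sum_squares big_ord0.
  by rewrite mul0r oppr0 expR0 mule1.
have mA' : measurable (@rV_cons R n @^-1` A).
  exact: measurable_preimage (@measurable_rV_cons R n) mA.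
rewrite /lebesgue_rV/= /rV_cons_measure /=.
rewrite (ge0_integral_pushforward (@measurable_rV_cons R n))//; last 2 first.
- by apply/measurable_EFinP/measurable_funTS; exact: measurable_gauss_pdf.
- by move=> x _; rewrite lee_fin gauss_pdf_ge0.
rewrite /pushforward.
rewrite (@product_measure_density _ _ _ _ R lebesgue_measure (@normal_prob R 0 s)
  (lebesgue_rV R n) _ (normal_pdf 0 s) (@gauss_pdf s n))//.
- by apply: eq_integral => z _ /=; rewrite gauss_pdf_cons.
- exact: measurable_normal_pdf.
- exact: measurable_gauss_pdf.
- by move=> x; exact: normal_pdf_ge0.
- by move=> x; exact: gauss_pdf_ge0.
Qed.

Lemma normal_power_setT s n : rV_power (@normal_prob R 0 s) n setT = 1.
Proof.
have := @rV_power_box R (@normal_prob R 0 s) n (fun=> setT) (fun=> measurableT).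
rewrite (_ : [set v | _] = setT); last by apply/seteqP; split.
move=> ->; rewrite big1// => j _; exact: (@probability_setT _ _ _ (@normal_prob R 0 s)).
Qed.

Lemma integral_gauss_pdf s n : (s != 0)%R ->
  \int[lebesgue_rV R n]_x (gauss_pdf s x)%:E = 1.
Proof. by move=> s0; rewrite -rV_power_normal// normal_power_setT. Qed.

Lemma integrable_gauss (c : R) n : (0 < c)%R ->
  (lebesgue_rV R n).-integrable setT
    (fun x : 'rV[R]_n => (expR (- (c * sum_squares x)))%:E).
Proof.
move=> c0; pose s := Num.sqrt (c *+ 2)^-1.
have s0 : (s != 0)%R by rewrite sqrtr_eq0 -ltNge invr_gt0 pmulrn_lgt0.
have sE : ((s ^+ 2 *+ 2)^-1 = c)%R.
  rewrite sqr_sqrtr ?invr_ge0 ?pmulrn_lge0 ?ltW// -[(c *+ 2)%R]mulr_natr.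
  by rewrite invfM -mulr_natr mulfVK ?pnatr_eq0// invrK.
have p0 : (0 < normal_peak s ^+ n)%R by rewrite exprn_gt0// normal_peak_gt0.
have -> : (fun x : 'rV[R]_n => (expR (- (c * sum_squares x)))%:E) =
    (fun x => ((normal_peak s ^+ n)^-1)%:E * (gauss_pdf s x)%:E).
  apply/funext => x; rewrite /gauss_pdf sE -EFinM mulrA mulVf ?gt_eqF// mul1r.
  by rewrite [(c * _)%R]mulrC.
apply: integrableZl => //; apply/integrableP; split.
  by apply/measurable_EFinP; exact: measurable_gauss_pdf.
under eq_integral do rewrite /= ger0_norm ?gauss_pdf_ge0//.
by rewrite integral_gauss_pdf// ltry.
Qed.

Section marginal.
Variable mu : probability (measurableTypeR R) R.

(** The dropped coordinates carry a probability measure, so they are integrated out one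
    at a time. *)
Lemma rV_power_rsubmx s k (A : set 'rV[R]_k) : measurable A ->
  rV_power mu (s + k) (@rsubmx R 1 s k @^-1` A) = rV_power mu k A.
Proof.
move=> mA; elim: s => [|s IH].
  congr (rV_power mu k _); apply/funext => x; rewrite /preimage/=; congr A.
  apply/rowP => j; rewrite mxE; congr (x _ _); exact/val_inj.
have mS : measurable (@rsubmx R 1 s k @^-1` A).
  apply: measurable_preimage mA; apply/measurable_fun_rVP => j.
  by under eq_fun do rewrite mxE; exact: measurable_rV_coor.
rewrite -IH -[rV_power mu (s + k) _]mul1e -(@probability_setT _ _ _ mu).
rewrite -(rV_cons_measureX _ _ measurableT mS).
rewrite /=; congr (rV_cons_measure _ _ _); apply/funext => x.
rewrite /preimage/=; apply/propext; split => [Ax|[_ Ax]].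
  split => //; move: Ax; congr A; apply/rowP => j; rewrite !mxE.
  by congr (x _ _); apply/val_inj; rewrite /= /bump.
move: Ax; congr A; apply/rowP => j; rewrite !mxE.
by congr (x _ _); apply/val_inj; rewrite /= /bump.
Qed.

End marginal.
End gaussian.

(** * The I-divergence and its quadratic approximation *)

Section scalar_entropy.
Context {R : realType}.
Implicit Types s h : R.

(** [q * entropy_excess (p / q)] is a term of [Idiv p q] to which the linear term
    [q - p], of zero total for two distributions, has been added: it vanishes to second
    order at [p = q]. *)
Definition entropy_excess s : R := s * ln s - s + 1.

Lemma ln_le_subr1 s : 0 < s -> ln s <= s - 1.
Proof.
move=> s0; have := @le_ln1Dx R (s - 1).
by rewrite (addrC 1) subrK; apply; rewrite ltrBrDl subrr.
Qed.

Lemma ln_ge_1subV s : 0 < s -> 1 - s^-1 <= ln s.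
Proof.
move=> s0; have sV0 : 0 < s^-1 by rewrite invr_gt0.
have := ln_le_subr1 sV0; rewrite lnV ?posrE//; lra.
Qed.

(** With [r = sqrt s], the inequality [ln r >= 1 - 1 / r] gives
    [entropy_excess s >= (r - 1) ^+ 2], and [(r + 1) ^+ 2 <= 2 * (s + 1)]. *)
Lemma entropy_excess_ge s : 0 <= s ->
  (s - 1) ^+ 2 / (2 * (s + 1)) <= entropy_excess s.
Proof.
move=> s_ge0; have d0 : 0 < 2 * (s + 1) by lra.
rewrite ler_pdivrMr// /entropy_excess.
move: s_ge0; rewrite le_eqVlt => /predU1P[<-|s0]; first by rewrite mul0r; lra.
pose r := Num.sqrt s; have r0 : 0 < r by rewrite sqrtr_gt0.
have sE : s = r ^+ 2 by rewrite sqr_sqrtr// ltW.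
have lnE : ln s = ln r *+ 2 by rewrite sE lnXn.
have lnr := ln_ge_1subV r0.
have H : 2 * s - 2 * r <= s * ln s.
  have -> : 2 * s - 2 * r = s * (2 - 2 * r^-1).
    by rewrite sE expr2; field; rewrite gt_eqF.
  by rewrite ler_wpM2l ?(ltW s0)// lnE mulr2n; lra.
have rE : (r - 1) ^+ 2 = s - 2 * r + 1 by rewrite sE; ring.
have {}H : (r - 1) ^+ 2 <= s * ln s - s + 1 by rewrite rE; lra.
apply: le_trans (ler_wpM2r (ltW d0) H).
have -> : (s - 1) ^+ 2 = (r - 1) ^+ 2 * (r + 1) ^+ 2 by rewrite sE; ring.
rewrite ler_wpM2l ?sqr_ge0// -subr_ge0.
have -> : 2 * (s + 1) - (r + 1) ^+ 2 = (r - 1) ^+ 2 by rewrite rE sE; ring.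
exact: sqr_ge0.
Qed.

(** The derivative [ln (1 + x) - x] of the difference is at most [2 * x ^+ 2] in absolute
    value, and the mean value theorem concludes. *)
Lemma entropy_excess_taylor h : `|h| <= 2^-1 ->
  `|entropy_excess (1 + h) - h ^+ 2 / 2| <= 2 * `|h| * h ^+ 2.
Proof.
move=> h_le.
pose psi (x : R) : R := (1 + x) * ln (1 + x) - x - x ^+ 2 / 2.
have psiE : entropy_excess (1 + h) - h ^+ 2 / 2 = psi h.
  by rewrite /entropy_excess /psi; ring.
have dpsi (x : R) : - 2^-1 <= x -> is_derive x 1 psi (ln (1 + x) - x).
  move=> x_ge; have x0 : 0 < 1 + x by lra.
  have D1 : is_derive x 1 (fun x : R => 1 + x) 1.
    by apply: is_derive_eq; rewrite add0r mulr1.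
  have D2 : is_derive x 1 (fun x : R => ln (1 + x)) (1 + x)^-1.
    have := @is_derive1_comp R (@ln R) _ x _ _ (is_derive1_ln x0) D1.
    by rewrite mulr1.
  rewrite /psi; apply: is_derive_eq.
  rewrite /GRing.scale/= !mulr1; field.
  by rewrite gt_eqF.
have psi'_le (x : R) : `|x| <= `|h| -> `|ln (1 + x) - x| <= 2 * h ^+ 2.
  move=> xh; have /andP[x1 x2] : - 2^-1 <= x <= 2^-1.
    by rewrite -ler_norml (le_trans xh).
  have x0 : 0 < 1 + x by lra.
  have h1 := ln_ge_1subV x0; have h2 := ln_le_subr1 x0.
  have xx : x ^+ 2 <= h ^+ 2 
    by rewrite -(real_normK (num_real x)) -(real_normK (num_real h)) lerXn2r ?nnegrE.
  rewrite ler_norml; apply/andP; split; last first.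
    by apply: (@le_trans _ _ 0); [lra|rewrite mulr_ge0 ?sqr_ge0].
  apply: le_trans (_ : - (x ^+ 2 / (1 + x)) <= _).
    rewrite lerN2 ler_pdivrMr//; nra.
  have -> : - (x ^+ 2 / (1 + x)) = 1 - (1 + x)^-1 - x.
    by field; rewrite gt_eqF.
  lra.
have cpsi (a b : R) : - 2^-1 <= a -> {within `[a, b], continuous psi}.
  move=> a0; apply: derivable_within_continuous => x; rewrite in_itv/= => /andP[ax _].
  by apply: ex_derive; apply: dpsi; lra.
have psi0 : psi 0 = 0 by rewrite /psi addr0 ln1; ring.
rewrite psiE.
have [h0|h0] := lerP 0 h.
  rewrite ger0_norm// in h_le.
  have half0 : - 2^-1 <= 0 :> R by lra.
  have [|c] := @MVT_segment R psi (fun x => ln (1 + x) - x) 0 h h0 _ (cpsi 0 h half0).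
    by move=> x; rewrite in_itv/= => /andP[? ?]; apply: dpsi; lra.
  rewrite in_itv/= => /andP[c0 ch]; rewrite psi0 !subr0 => ->.
  rewrite normrM mulrAC ler_wpM2r// psi'_le//.
  by rewrite !ger0_norm.
rewrite ltr0_norm// in h_le.
have halfh : - 2^-1 <= h by lra.
have [|c] := @MVT_segment R psi (fun x => ln (1 + x) - x) h 0 (ltW h0) _ (cpsi h 0 halfh).
  by move=> x; rewrite in_itv/= => /andP[? ?]; apply: dpsi; lra.
rewrite in_itv/= => /andP[c0 ch]; rewrite psi0 !sub0r => /eqP; rewrite eqr_oppLR => /eqP ->.
rewrite normrN normrM normrN mulrAC ler_wpM2r// psi'_le//.
by rewrite !ler0_norm ?lerN2// ltW.
Qed.

End scalar_entropy.

Section divergence.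
Context {R : realType} {n : nat}.
Implicit Types p q r : 'rV[R]_n.

(** Pearson's chi-squared divergence, the square of the length of [p - q] in the Fisher
    metric at [q]. *)
Definition pearson p q : R := \sum_e (p 0 e - q 0 e) ^+ 2 / q 0 e.

Lemma pearson_ge0 p q : (forall e, 0 < q 0 e) -> 0 <= pearson p q.
Proof. by move=> q0; apply: sumr_ge0 => e _; rewrite divr_ge0 ?sqr_ge0 ?ltW. Qed.

Lemma simplex_le1 p e : simplex p -> p 0 e <= 1.
Proof.
move=> [p0 <-]; rewrite (bigD1 e)//= lerDl sumr_ge0// => i _; exact: p0.
Qed.

Lemma Idiv_excess p q : (forall e, 0 < q 0 e) ->
  \sum_e p 0 e = \sum_e q 0 e ->
  Idiv p q = \sum_e q 0 e * entropy_excess (p 0 e / q 0 e).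
Proof.
move=> q0 pq.
have -> : Idiv p q = Idiv p q - \sum_e p 0 e + \sum_e q 0 e.
  by rewrite pq subrK.
rewrite /Idiv -sumrB -big_split/=; apply: eq_bigr => e _.
by rewrite /entropy_excess; field; rewrite gt_eqF.
Qed.

Lemma Idiv_le_pearson p q : (forall e, 0 < q 0 e) -> (forall e, 0 <= p 0 e) ->
  \sum_e p 0 e = \sum_e q 0 e -> Idiv p q <= pearson p q.
Proof.
move=> q0 p0 pq; rewrite Idiv_excess//; apply: ler_sum => e _.
set s := p 0 e / q 0 e; have pE : p 0 e = s * q 0 e.
  by rewrite divfK// gt_eqF.
have s0 : 0 <= s by rewrite divr_ge0// ltW.
have -> : (p 0 e - q 0 e) ^+ 2 / q 0 e = q 0 e * (s - 1) ^+ 2.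
  by rewrite pE; field; rewrite gt_eqF.
rewrite ler_wpM2l ?(ltW (q0 _))// /entropy_excess.
have /predU1P[<-|{}s0] : (0 == s) || (0 < s) by rewrite -le_eqVlt.
  by rewrite mul0r subrr add0r sub0r sqrrN expr1n.
have H : s * ln s <= s * (s - 1) by rewrite ler_wpM2l ?(ltW s0)// ln_le_subr1.
by move: H; rewrite mulrBr mulr1 sqrrB1 expr2; lra.
Qed.

(** The ratios [p / q] are bounded on the simplex, so the bound of [entropy_excess_ge] is
    uniform there. *)
Lemma Idiv_ge_pearson p q : simplex p -> simplex q -> (forall e, 0 < q 0 e) ->
  pearson p q / (2 * (1 + \sum_e (q 0 e)^-1)) <= Idiv p q.
Proof.
move=> sp sq q0; rewrite Idiv_excess//; last by rewrite sp.2 sq.2.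
rewrite /pearson mulr_suml; apply: ler_sum => e _.
set s := p 0 e / q 0 e; have pE : p 0 e = s * q 0 e.
  by rewrite divfK// gt_eqF.
have s0 : 0 <= s by rewrite divr_ge0 ?sp.1// ltW.
have -> : (p 0 e - q 0 e) ^+ 2 / q 0 e = q 0 e * (s - 1) ^+ 2.
  by rewrite pE; field; rewrite gt_eqF.
rewrite -mulrA ler_wpM2l ?(ltW (q0 _))//; apply: le_trans (entropy_excess_ge s0).
rewrite ler_wpM2l ?sqr_ge0// lef_pV2 ?posrE; first last.
- by rewrite mulr_gt0// ltr_wpDl.
- by rewrite mulr_gt0// ltr_wpDr// sumr_ge0// => i _; rewrite invr_ge0 ltW.
rewrite ler_wpM2l// addrC lerD2l (bigD1 e)//= ler_wpDr//.
  by rewrite sumr_ge0// => i _; rewrite invr_ge0 ltW.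
by rewrite ler_piMl ?simplex_le1 ?invr_ge0 ?(ltW (q0 _)).
Qed.

Lemma Idiv_taylor p q (eta : R) : (forall e, 0 < q 0 e) ->
  \sum_e p 0 e = \sum_e q 0 e -> eta <= 2^-1 ->
  (forall e, `|p 0 e / q 0 e - 1| <= eta) ->
  `|Idiv p q - pearson p q / 2| <= 2 * eta * pearson p q.
Proof.
move=> q0 pq eta_le pq_eta; rewrite Idiv_excess// /pearson mulr_suml -sumrB mulr_sumr.
apply: (le_trans (ler_norm_sum _ _ _)); apply: ler_sum => e _.
set h := p 0 e / q 0 e - 1; have pE : p 0 e = (1 + h) * q 0 e.
  by rewrite addrC subrK divfK// gt_eqF.
have -> : (p 0 e - q 0 e) ^+ 2 / q 0 e = q 0 e * h ^+ 2.
  by rewrite pE; field; rewrite gt_eqF.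
have -> : p 0 e / q 0 e = 1 + h by rewrite addrC subrK.
rewrite -mulrA -mulrBr normrM (gtr0_norm (q0 e)) mulrCA ler_wpM2l ?(ltW (q0 _))//.
have h_eta : `|h| <= eta by exact: pq_eta.
apply: (le_trans (entropy_excess_taylor (le_trans h_eta eta_le))).
by rewrite ler_wpM2r ?sqr_ge0// ler_wpM2l.
Qed.

Lemma Idiv_change_reference p q r : (forall e, 0 <= p 0 e) ->
  (forall e, 0 < q 0 e) -> (forall e, 0 < r 0 e) ->
  Idiv p r = Idiv p q + \sum_e p 0 e * ln (q 0 e / r 0 e).
Proof.
move=> p0 q0 r0; rewrite /Idiv -big_split/=; apply: eq_bigr => e _.
have /predU1P[<-|pe] : (0 == p 0 e) || (0 < p 0 e) by rewrite -le_eqVlt.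
  by rewrite !mul0r addr0.
rewrite -mulrDr -lnM ?posrE ?divr_gt0// mulrA divfK// gt_eqF//; exact: q0.
Qed.

(** A polynomial with no constant term cannot keep its sign around zero unless its linear
    coefficient vanishes; the test point is a small step against the sign of [l]. *)
Lemma linear_coef_eq0 (l C tau : R) : 0 < tau -> 0 <= C ->
  (forall t, `|t| <= tau -> 0 <= t * l + t ^+ 2 * C) -> l = 0.
Proof.
move=> tau0 C0 H; apply/eqP/negPn/negP => l0.
pose d := 1 + C + `|l| / tau.
have lt0 : 0 <= `|l| / tau by rewrite divr_ge0// ltW.
have d0 : 0 < d by rewrite /d; lra.
have /H : `|- (l / d)| <= tau.
  rewrite normrN normrM normfV (gtr0_norm d0) ler_pdivrMr//.
  by rewrite mulrC -ler_pdivrMr// /d; lra.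
have -> : - (l / d) * l + (- (l / d)) ^+ 2 * C = (l / d) ^+ 2 * (C - d).
  by field; rewrite gt_eqF.
have ld : 0 < (l / d) ^+ 2.
  by rewrite exprn_even_gt0//= mulf_neq0// invr_eq0 gt_eqF.
by rewrite pmulr_rge0// /d; lra.
Qed.

End divergence.

Section totemplices.
Context {R : realType} {n : nat}.
Implicit Types p q r g : 'rV[R]_n.

Lemma totemplexP D g (M : 'M[R]_(D, n)) p :
  totemplex g M p <-> simplex p /\ (p - g <= ker_vop M)%MS.
Proof.
split=> -[sp gp]; split => //.
  apply/ker_vopP => a; under eq_bigr do rewrite !mxE mulrBr.
  by rewrite sumrB gp subrr.
move=> a; move/ker_vopP : gp => /(_ a); under eq_bigr do rewrite !mxE mulrBr.
by rewrite sumrB => /eqP; rewrite subr_eq0 => /eqP.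
Qed.

Lemma ker_vop_implies D D' (M : 'M[R]_(D, n)) (M' : 'M[R]_(D', n)) :
  vop_implies M' M -> (ker_vop M' <= ker_vop M)%MS.
Proof.
move=> [S _ ->]; apply/sub_kermxP.
by rewrite trmx_mul mulmxA mulmx_ker mul0mx.
Qed.

Lemma totemplex_trans D D' (M : 'M[R]_(D, n)) (M' : 'M[R]_(D', n)) g p :
  (ker_vop M' <= ker_vop M)%MS -> totemplex g M p ->
  totemplex p M' `<=` totemplex g M.
Proof.
move=> kerS /totemplexP[_ pg] z /totemplexP[sz zp]; apply/totemplexP; split=> //.
by rewrite -(subrKA p) addmx_sub// (submx_trans zp).
Qed.

(** Normalization: the kernel of [M] is orthogonal to the constants as soon as these are
    in the span of [M]. *)
Lemma sum_ker_vop D (M : 'M[R]_(D, n)) p : ((const_mx 1 : 'rV[R]_n) <= M)%MS ->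
  (p <= ker_vop M)%MS -> \sum_e p 0 e = 0.
Proof.
move=> /submxP[a aM] /sub_kermxP pM.
have : p *m (const_mx 1 : 'rV[R]_n)^T = 0 by rewrite aM trmx_mul mulmxA pM mul0mx.
move/matrixP => /(_ 0 0); rewrite !mxE => H; rewrite -[RHS]H.
by apply: eq_bigr => e _; rewrite !mxE mulr1.
Qed.

Lemma mxrank_ker_vop D (M : 'M[R]_(D, n)) : row_free M ->
  \rank (ker_vop M) = (n - D)%N.
Proof. by move=> fM; rewrite mxrank_ker mxrank_tr (eqP fM). Qed.

(** The difference of the two sides is [\sum_e (p e - q e) * ln (q e / ups e)], the
    derivative at [q] of the divergence in the direction [p - q]. As [q] is positive, the
    segment from [p] to [q] can be extended beyond [q], and minimality makes the
    derivative vanish. *)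
Lemma Iprojection_pythagoras D (M : 'M[R]_(D, n)) g (ups q p : 'rV[R]_n) :
  (forall e, 0 < ups 0 e) -> (forall e, 0 < q 0 e) ->
  is_Iprojection ups (totemplex g M) q -> totemplex g M p ->
  Idiv p ups = Idiv p q + Idiv q ups.
Proof.
move=> ups0 q0 [qA qmin] pA.
have [sq qg] := (totemplexP g M q).1 qA.
have [sp pg] := (totemplexP g M p).1 pA.
have pqM : (p - q <= ker_vop M)%MS.
  by rewrite -(subrKA g) addmx_sub// -opprB -scaleN1r scalemx_sub.
pose l := \sum_e (p 0 e - q 0 e) * ln (q 0 e / ups 0 e).
pose S := 1 + \sum_e (q 0 e)^-1.
have S0 : 0 < S by rewrite ltr_wpDr// sumr_ge0// => i _; rewrite invr_ge0 ltW.
have q_ge e : S^-1 <= q 0 e.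
  rewrite -[leRHS]invrK lef_pV2 ?posrE ?invr_gt0// /S ler_wpDl// (bigD1 e)//=.
  by rewrite lerDl sumr_ge0// => i _; rewrite invr_ge0 ltW.
have l0 : l = 0.
  (* [S^-1] is a lower bound of the entries of [q], and [p - q] has entries of absolute
     value at most 1, so the steps of size [S^-1] stay in the simplex *)
  apply: (@linear_coef_eq0 _ l (pearson p q) S^-1); rewrite ?invr_gt0 ?pearson_ge0//.
  move=> t tS; pose z := q + t *: (p - q).
  have zE e : z 0 e = q 0 e + t * (p 0 e - q 0 e) by rewrite !mxE.
  have z0 e : 0 <= z 0 e.
    rewrite zE -(opprK (t * _)) subr_ge0.
    apply: (le_trans (ler_norm _)); rewrite normrN normrM.
    apply: le_trans (q_ge e); rewrite -[leRHS]mulr1 ler_pM//.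
    have := simplex_le1 e sp; have := simplex_le1 e sq.
    by have := sp.1 e; have := sq.1 e; rewrite ler_norml; lra.
  have z1 : \sum_e z 0 e = 1.
    under eq_bigr do rewrite zE; rewrite big_split/= -mulr_sumr sumrB sp.2 sq.2.
    by rewrite subrr mulr0 addr0.
  have zA : totemplex g M z.
    apply/totemplexP; split; first by split.
    by rewrite /z addrAC addmx_sub// scalemx_sub.
  have := qmin _ zA; rewrite (Idiv_change_reference z0 q0 ups0).
  have -> : \sum_e z 0 e * ln (q 0 e / ups 0 e) = Idiv q ups + t * l.
    rewrite /Idiv /l mulr_sumr -big_split/=; apply: eq_bigr => e _.
    by rewrite zE; ring.
  rewrite addrCA lerDl addrC => /le_trans; apply; rewrite lerD2l.
  apply: le_trans (Idiv_le_pearson q0 z0 _) _; first by rewrite z1 sq.2.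
  rewrite /pearson mulr_sumr; apply: ler_sum => e _.
  by rewrite zE [q 0 e + _]addrC addrK exprMn -mulrA.
rewrite (Idiv_change_reference sp.1 q0 ups0); congr (_ + _).
apply/eqP; rewrite -subr_eq0 /Idiv -sumrB; apply/eqP; rewrite -[RHS]l0.
by apply: eq_bigr => e _; rewrite mulrBl.
Qed.

(** On the ambient totemplex, the divergences to [ups] and to [q] differ by a constant. *)
Lemma inner_Iprojection D D' (M : 'M[R]_(D, n)) (M' : 'M[R]_(D', n)) g
    (ups q x qx : 'rV[R]_n) :
  (forall e, 0 < ups 0 e) -> (forall e, 0 < q 0 e) ->
  (ker_vop M' <= ker_vop M)%MS ->
  is_Iprojection ups (totemplex g M) q -> totemplex g M x ->
  is_Iprojection ups (totemplex x M') qx ->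
  is_Iprojection q (totemplex x M') qx.
Proof.
move=> ups0 q0 kerS qP xA [qxA qxmin]; split=> // p pA.
have sub := totemplex_trans kerS xA.
have := qxmin _ pA.
rewrite (Iprojection_pythagoras ups0 q0 qP (sub _ qxA)).
by rewrite (Iprojection_pythagoras ups0 q0 qP (sub _ pA)) lerD2r.
Qed.

End totemplices.

(** * Measurability of the inner divergence *)

Section borel_rV.
Context {R : realType}.

(** An open set is the union of the boxes with rational centres and inverse integer
    radii that it contains. *)
Lemma open_measurable_rV n (U : set 'rV[R]_n) : open U -> measurable U.
Proof.
move=> oU.
pose box (ck : 'rV[rat]_n * nat) : set 'rV[R]_n :=
  [set v | forall j, `](ratr (ck.1 0 j) - ck.2.+1%:R^-1),
                       (ratr (ck.1 0 j) + ck.2.+1%:R^-1)[%classic (v 0 j)].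
pose F ck := if asbool (box ck `<=` U) then box ck else set0.
have -> : U = \bigcup_ck F ck.
  apply/seteqP; split=> [x Ux|x [ck _]]; last first.
    by rewrite /F; case: asboolP => // bU; exact: bU.
  have /nbhs_ballP[e /= e0 xeU] : nbhs x U by exact: open_nbhs_nbhs.
  pose k := Num.truncn (2 / e).
  have k0 : 0 < k.+1%:R^-1 :> R by rewrite invr_gt0.
  have ke : k.+1%:R^-1 * 2 < e.
    rewrite -ltr_pdivlMr// -[ltRHS]invrK ltf_pV2 ?posrE ?invr_gt0 ?divr_gt0//.
    by rewrite invf_div truncnS_gt.
  have /choice[c cx] j : exists r : rat, ratr r \in
      `](x 0 j - k.+1%:R^-1), (x 0 j + k.+1%:R^-1)[.
    by apply: rat_in_itvoo; rewrite ltrD2l (lt_trans _ k0)// oppr_lt0.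
  have xb : box (\row_j c j, k) x.
    by move=> j /=; have := cx j; rewrite !mxE !in_itv/=; move: _^-1 => ek; lra.
  exists (\row_j c j, k) => //; rewrite /F; case: asboolP => // -[].
  move=> v vb; apply: xeU; split=> // i j; rewrite ord1 /ball/=.
  have := vb j; have := cx j; rewrite /= !mxE !in_itv/= ltr_norml; move: ke.
  by move: _^-1 => ek; lra.
apply: countable_bigcupT_measurable => // ck; rewrite /F; case: ifP => // _.
apply: (@measurable_rV_box _ _ (fun j =>
  `](ratr (ck.1 0 j) - ck.2.+1%:R^-1), (ratr (ck.1 0 j) + ck.2.+1%:R^-1)[%classic)).
by move=> j; exact: measurable_itv.
Qed.

Lemma closed_measurable_rV n (C : set 'rV[R]_n) : closed C -> measurable C.
Proof.
move=> cC; rewrite -[C]setCK; apply: measurableC; apply: open_measurable_rV.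
exact: closed_openC.
Qed.

Lemma continuous_sumr (T : topologicalType) (I : Type) (s : seq I) (f : I -> T -> R) :
  (forall i, continuous (f i)) -> continuous (fun x => \sum_(i <- s) f i x).
Proof.
move=> cf; elim: s => [|i s IH] x.
  by under eq_fun do rewrite big_nil; exact: cvg_cst.
under eq_fun do rewrite big_cons.
by apply: cvgD; [exact: cf|exact: IH].
Qed.

Lemma continuous_rV (T : topologicalType) n (f : T -> 'rV[R]_n) :
  (forall j, continuous (fun x => f x 0 j)) -> continuous f.
Proof.
move=> cf x; apply/cvg_ballP => e e0.
have : \forall y \near x, forall j, ball (f x 0 j) e (f y 0 j).
  apply: filter_forall => j; have /cvg_ballP := cf j x.
  by move=> /(_ e e0).
by apply: filterS => y H; split=> // i j; rewrite ord1.
Qed.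

Lemma continuous_mulmxr m n (L : 'M[R]_(m, n)) :
  continuous (fun x : 'rV[R]_m => x *m L).
Proof.
apply: continuous_rV => j; under eq_fun do rewrite mxE.
apply: continuous_sumr => i x; apply: continuousM; last exact: cst_continuous.
exact: coord_continuous.
Qed.

Lemma xlnx_norm_le (x : R) : `|x * ln x| <= 2 * Num.sqrt x + x ^+ 2.
Proof.
have [x0|x0] := lerP x 0.
  by rewrite ln0// mulr0 normr0 addr_ge0 ?sqr_ge0// mulr_ge0 ?sqrtr_ge0.
pose r := Num.sqrt x; have r0 : 0 < r by rewrite sqrtr_gt0.
have xE : x = r ^+ 2 by rewrite sqr_sqrtr// ltW.
have h1 : x * ln x <= x * (x - 1) by rewrite ler_wpM2l ?(ltW x0)// ln_le_subr1.
have h2 : - (2 * r) <= x * ln x.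
  have -> : - (2 * r) = x * (- r^-1 * 2).
    by rewrite xE expr2; field; rewrite gt_eqF.
  rewrite ler_wpM2l ?(ltW x0)// xE lnXn// -[leRHS]mulr_natr ler_wpM2r//.
  by have := ln_ge_1subV r0; lra.
by rewrite ler_norml -/r; have := sqr_ge0 x; rewrite expr2; lra.
Qed.

(** At zero the function is squeezed by [xlnx_norm_le]; on the negative side it is
    constant, since [ln] is zero there. *)
Lemma continuous_xlnx : continuous (fun x : R => x * ln x).
Proof.
move=> x; have [x0|x0|->] := ltrgtP x 0.
- have xlnx0 : {near x, cst 0 =1 (fun y : R => y * ln y)}.
    by near=> y; rewrite /= ln0 ?mulr0//; near: y; exact: lt_le_nbhsl.
  apply: cvg_trans (near_eq_cvg xlnx0) _.
  by rewrite ln0 ?mulr0; [exact: cvg_cst|exact: ltW].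
- by apply: cvgM; [exact: cvg_id|exact: continuous_ln].
- rewrite /continuous_at mul0r; apply/norm_cvg0P.
  apply: (@squeeze_cvgr _ _ _ _ (cst 0) (fun y : R => 2 * Num.sqrt y + y ^+ 2)).
  + by apply: nearW => y; rewrite normr_ge0 xlnx_norm_le.
  + exact: cvg_cst.
  + have C : continuous (fun y : R => 2 * Num.sqrt y + y ^+ 2).
      move=> y; apply: cvgD; last exact: (@exprn_continuous R 2%N y).
      by apply: cvgM; [exact: cvg_cst|exact: sqrt_continuous].
    by have := C 0; rewrite /continuous_at sqrtr0 mulr0 expr0n addr0.
Unshelve. all: by end_near. Qed.

End borel_rV.

Section inner_divergence_measurable.
Context {R : realType} {n : nat}.
Implicit Types p q r g x z : 'rV[R]_n.

Lemma continuous_Idiv q : (forall e, 0 < q 0 e) -> continuous (Idiv^~ q).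
Proof.
move=> q0; have -> : Idiv^~ q =
    fun z : 'rV[R]_n => \sum_e q 0 e * (z 0 e / q 0 e * ln (z 0 e / q 0 e)).
  apply/funext => z; rewrite /Idiv; apply: eq_bigr => e _.
  by rewrite mulrA [q 0 e * _]mulrC divfK// gt_eqF.
apply: continuous_sumr => e z.
have cz : {for z, continuous (fun z : 'rV[R]_n => z 0 e / q 0 e)}.
  apply: (@continuousM R _ (fun z : 'rV[R]_n => z 0 e) (cst (q 0 e)^-1)).
    exact: coord_continuous.
  exact: cst_continuous.
have cl := continuous_comp cz (@continuous_xlnx R _).
by apply: (continuousM (s := cst (q 0 e))) cl; exact: cst_continuous.
Qed.

Lemma measurable_Idiv q : (forall e, 0 < q 0 e) ->
  measurable_fun setT (Idiv^~ q).
Proof.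
move=> q0; apply: measurable_sum => e; apply: measurable_funM.
  exact: measurable_rV_coor.
apply: measurableT_comp; first exact: measurable_ln.
by apply: measurable_funM => //; exact: measurable_rV_coor.
Qed.

Lemma closed_simplex : closed (@simplex R n).
Proof.
have -> : @simplex R n = \bigcap_e [set p : 'rV[R]_n | 0 <= p 0 e] `&`
    (fun p => \sum_e p 0 e) @^-1` [set x | x = 1].
  apply/seteqP; split=> p /= [p0 p1]; split=> // e; first by move=> _; exact: p0.
  exact: p0.
apply: closedI.
  apply: closed_bigI => e _; apply: (@preimage_closed _ _ (fun p => p 0 e) [set x | 0 <= x]).
    by move=> p _; exact: coord_continuous.
  exact: closed_ge.
apply: preimage_closed; last exact: closed_eq.
by move=> p _; apply: continuous_sumr => e; exact: coord_continuous.
Qed.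

Lemma totemplex_mulmx D g (M : 'M[R]_(D, n)) p :
  totemplex g M p <-> simplex p /\ p *m M^T = g *m M^T.
Proof.
rewrite totemplexP; split=> -[sp pg]; split=> //.
  by apply/eqP; rewrite -subr_eq0 -mulmxBl; apply/eqP/sub_kermxP.
by apply/sub_kermxP; rewrite mulmxBl pg subrr.
Qed.

Lemma closed_totemplex D g (M : 'M[R]_(D, n)) : closed (totemplex g M).
Proof.
have -> : totemplex g M = simplex `&` (fun p => p *m M^T) @^-1` [set g *m M^T].
  by apply/seteqP; split=> p /totemplex_mulmx.
apply: closedI; first exact: closed_simplex.
apply: preimage_closed; first by move=> p _; exact: continuous_mulmxr.
exact/accessible_closed_set1/hausdorff_accessible/norm_hausdorff.
Qed.

Lemma measurable_totemplex D g (M : 'M[R]_(D, n)) : measurable (totemplex g M).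
Proof. exact: closed_measurable_rV (@closed_totemplex _ _ _). Qed.

Lemma compact_simplex : compact (@simplex R n).
Proof.
have cube01 := @rV_compact R n (fun=> `[0 : R, 1 : R]%classic) (fun=> @segment_compact R 0 1).
apply: subclosed_compact closed_simplex cube01 _ => p sp e.
by rewrite /= in_itv/= sp.1 simplex_le1.
Qed.

(** A fibre of [M'] is determined by the image of its points under [M'], so this set is
    the trace on the totemplex of the preimage of a compact set: the image under [M'] of
    the points of divergence at most [t]. *)
Lemma measurable_inner_sublevel D D' (M : 'M[R]_(D, n)) (M' : 'M[R]_(D', n)) g q t :
  (forall e, 0 < q 0 e) -> (ker_vop M' <= ker_vop M)%MS ->
  measurable [set x | totemplex g M x /\ exists2 z, totemplex x M' z & Idiv z q <= t].
Proof.
move=> q0 kerS.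
pose K := totemplex g M `&` Idiv^~ q @^-1` [set s | s <= t].
have cK : compact K.
  apply: (subclosed_compact _ compact_simplex) => [|z [[]]//].
  apply: closedI; first exact: closed_totemplex.
  apply: preimage_closed; last exact: closed_le.
  by move=> p _; exact: continuous_Idiv.
pose h := fun z : 'rV[R]_n => z *m M'^T.
have chK : compact (h @` K).
  apply: continuous_compact => //.
  exact/continuous_subspaceT/continuous_mulmxr.
have -> : [set x | totemplex g M x /\ exists2 z, totemplex x M' z & Idiv z q <= t]
    = totemplex g M `&` h @^-1` (h @` K).
  apply/seteqP; split=> x /= [xA].
    move=> [z zx zt]; split=> //; exists z.
      by split=> //; exact: totemplex_trans kerS xA _ zx.
    by have [] := (totemplex_mulmx x M' z).1 zx.
  move=> [z [zA zt] zx]; split=> //; exists z => //.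
  by apply/totemplex_mulmx; split=> //; case: zA.
apply: measurableI; first exact: measurable_totemplex.
apply: measurable_preimage; first exact: measurable_mulmxr.
apply: closed_measurable_rV; apply: compact_closed => //.
Qed.

End inner_divergence_measurable.

(** * Local asymptotics in the Fisher metric *)

Section fisher_metric.
Context {R : realType} {n : nat}.
Variable q : 'rV[R]_n.
Hypothesis q0 : forall e, 0 < q 0 e.
Implicit Types (u v : 'rV[R]_n).

Definition fisher : 'M[R]_n := diag_mx (\row_e (q 0 e)^-1).

Lemma fisher_sym : fisher^T = fisher. Proof. exact: tr_diag_mx. Qed.

Lemma pearson_fisher u : pearson (q + u) q = (u *m fisher *m u^T) 0 0.
Proof.
rewrite /pearson mul_mx_diag mxE; apply: eq_bigr => e _.
by rewrite !mxE [q 0 e + _]addrC addrK expr2 mulrAC.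
Qed.

Lemma fisher_pos u : u != 0 -> 0 < (u *m fisher *m u^T) 0 0.
Proof.
move=> u0; rewrite -pearson_fisher lt0r pearson_ge0// andbT.
apply: contra u0 => /eqP u0; apply/eqP/rowP => e; rewrite mxE; apply/eqP.
have term_ge0 i : true -> 0 <= ((q + u) 0 i - q 0 i) ^+ 2 / q 0 i.
  by rewrite divr_ge0 ?sqr_ge0// ltW.
have /eqP : ((q + u) 0 e - q 0 e) ^+ 2 / q 0 e = 0.
  exact: (psumr_eq0P term_ge0 u0).
by rewrite !mxE [q 0 e + _]addrC addrK mulf_eq0 invr_eq0 (gt_eqF (q0 e)) orbF sqrf_eq0.
Qed.

Lemma fisher_ge0 u : 0 <= (u *m fisher *m u^T) 0 0.
Proof. by rewrite -pearson_fisher pearson_ge0. Qed.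

Lemma sum_squaresE k (y : 'rV[R]_k) : (y *m y^T) 0 0 = sum_squares y.
Proof. by rewrite mxE; apply: eq_bigr => j _; rewrite mxE expr2. Qed.

Lemma fisher_orthonormal k (B : 'M[R]_(k, n)) (y : 'rV[R]_k) :
  orthonormal_rows fisher B ->
  ((y *m B) *m fisher *m (y *m B)^T) 0 0 = sum_squares y.
Proof.
move=> oB; rewrite trmx_mul -!mulmxA (mulmxA B) (mulmxA _ B^T) oB mul1mx.
exact: sum_squaresE.
Qed.

Lemma fisher_bessel k (B : 'M[R]_(k, n)) u : orthonormal_rows fisher B ->
  sum_squares (u *m fisher *m B^T) <= (u *m fisher *m u^T) 0 0.
Proof.
move=> oB; pose y := u *m fisher *m B^T; pose w : 'rV_n := u - y *m B.
have wB : w *m fisher *m B^T = 0.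
  by rewrite /w !mulmxBl -!mulmxA (mulmxA B) oB mulmx1 /y mulmxA subrr.
have Bw : B *m fisher *m w^T = 0 by exact: orthogonal_rows_sym fisher_sym _ _ _ _ wB.
have uE : u = y *m B + w by rewrite addrC subrK.
have yE : u *m fisher *m B^T = y by [].
rewrite yE; clearbody y w.
have yBw : y *m B *m fisher *m w^T = 0 by rewrite -!mulmxA (mulmxA B) Bw mulmx0.
have wyB : w *m fisher *m (y *m B)^T = 0 by rewrite trmx_mul mulmxA wB mul0mx.
have -> : u *m fisher *m u^T =
    (y *m B) *m fisher *m (y *m B)^T + w *m fisher *m w^T.
  by rewrite uE linearD/= !mulmxDl !mulmxDr yBw wyB addr0 add0r.
by rewrite mxE fisher_orthonormal// lerDl fisher_ge0.
Qed.

End fisher_metric.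

Section local_asymptotics.
Context {R : realType} {n : nat}.
Variable q : 'rV[R]_n.
Hypotheses (q0 : forall e, 0 < q 0 e) (sq : simplex q).
Implicit Types (u v : 'rV[R]_n).

(** With [N.+1] instead of [N] the scale is never zero; the index is shifted back at the
    level of the distribution functions. *)
Definition root_scale (N : nat) : R := (Num.sqrt N.+1%:R)^-1.

Lemma root_scale_gt0 N : 0 < root_scale N.
Proof. by rewrite invr_gt0 sqrtr_gt0. Qed.

Lemma root_scale_sqr N : root_scale N ^+ 2 = N.+1%:R^-1.
Proof. by rewrite exprVn sqr_sqrtr. Qed.

Lemma cvg_root_scale : root_scale @ \oo --> 0.
Proof.
have -> : root_scale = (fun N => Num.sqrt (harmonic N)).
  by apply/funext => N; rewrite /root_scale /harmonic/= -sqrtrV.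
rewrite -(sqrtr0 R); apply: continuous_cvg; first exact: sqrt_continuous.
exact: cvg_harmonic.
Qed.

(** This is where the positivity of [q] makes every direction of total zero admissible. *)
Lemma near_simplex u : \sum_e u 0 e = 0 ->
  \forall N \near \oo, simplex (q + root_scale N *: u).
Proof.
move=> u0.
have : \forall N \near \oo, forall e, 0 <= q 0 e + root_scale N * u 0 e.
  apply: filter_forall => e.
  have H : q 0 e + root_scale N * u 0 e @[N --> \oo] --> q 0 e + 0 * u 0 e.
    by apply: cvgD; [exact: cvg_cst|apply: cvgM; [exact: cvg_root_scale|exact: cvg_cst]].
  rewrite mul0r addr0 in H.
  by apply: (cvgr_ge _ H); exact: q0.
apply: filterS => N H; split=> [e|]; first by rewrite !mxE.
under eq_bigr do rewrite !mxE.
by rewrite big_split/= -mulr_sumr u0 mulr0 addr0 sq.2.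
Qed.

Lemma pearson_scale u (c : R) : pearson (q + c *: u) q = c ^+ 2 * pearson (q + u) q.
Proof.
rewrite /pearson mulr_sumr; apply: eq_bigr => e _; rewrite !mxE.
by rewrite ![q 0 e + _]addrC !addrK exprMn -mulrA.
Qed.

Lemma cvg_scaled_Idiv u : \sum_e u 0 e = 0 ->
  N.+1%:R * Idiv (q + root_scale N *: u) q @[N --> \oo] --> pearson (q + u) q / 2.
Proof.
move=> u0; pose K : R := \sum_e `|u 0 e| / q 0 e; pose c := pearson (q + u) q.
have K0 : 0 <= K by apply: sumr_ge0 => e _; rewrite divr_ge0// ltW.
have c0 : 0 <= c by exact: pearson_ge0.
have rK : root_scale N * K @[N --> \oo] --> 0.
  by rewrite -(mul0r K); apply: cvgM; [exact: cvg_root_scale|exact: cvg_cst].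
apply/cvgrPdist_le => eps eps0.
have e0 : 0 < eps / (2 * (c + 1)) by rewrite divr_gt0// mulr_gt0// ltr_wpDl.
near=> N.
have rhalf : root_scale N * K <= 2^-1.
  by near: N; apply: (cvgr_le _ rK); rewrite invr_gt0.
have reps : root_scale N * K <= eps / (2 * (c + 1)).
  by near: N; apply: (cvgr_le _ rK).
move: rhalf reps; set r := root_scale N => rhalf reps.
have r0 : 0 < r by exact: root_scale_gt0.
rewrite distrC.
have H : `|Idiv (q + r *: u) q - pearson (q + r *: u) q / 2| <=
    2 * (r * K) * pearson (q + r *: u) q.
  apply: Idiv_taylor => //.
    under eq_bigr do rewrite !mxE.
    by rewrite big_split/= -mulr_sumr u0 mulr0 addr0.
  move=> e; rewrite !mxE mulrDl mulfV ?gt_eqF// [1 + _]addrC addrK -mulrA normrM gtr0_norm//.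
  rewrite ler_wpM2l ?(ltW r0)// normrM normfV (gtr0_norm (q0 e)).
  rewrite /K (bigD1 e)//= lerDl sumr_ge0// => i _.
  by rewrite divr_ge0// ltW.
move: H; rewrite pearson_scale -/c root_scale_sqr => H.
have N0 : 0 < N.+1%:R :> R by [].
rewrite -(ler_pM2l N0) in H.
apply: (@le_trans _ _ (2 * (r * K) * c)).
  apply: le_trans (le_trans _ H) _.
    rewrite -{2}(gtr0_norm N0) -normrM mulrBr.
    by rewrite (_ : N.+1%:R * (N.+1%:R^-1 * c / 2) = c / 2)//; field; rewrite addrC natr1 pnatr_eq0.
  by rewrite (_ : N.+1%:R * _ = 2 * (r * K) * c)//; field; rewrite addrC natr1 pnatr_eq0.
apply: (@le_trans _ _ (2 * (eps / (2 * (c + 1))) * c)).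
  by rewrite ler_wpM2r// ler_wpM2l.
have -> : 2 * (eps / (2 * (c + 1))) * c = eps * (c / (c + 1)).
  by field; rewrite gt_eqF// ltr_wpDl.
rewrite ler_piMr ?(ltW eps0)// ler_pdivrMr ?ltr_wpDl// mul1r lerDl//.
Unshelve. all: by end_near. Qed.

End local_asymptotics.

Section inner_divergence_limit.
Context {R : realType} {n s k D D' : nat}.
Variables (q : 'rV[R]_n) (M : 'M[R]_(D, n)) (M' : 'M[R]_(D', n)).
Variables (B1 : 'M[R]_(s, n)) (B2 : 'M[R]_(k, n)).
Hypotheses (q0 : forall e, 0 < q 0 e) (sq : simplex q).
Hypothesis M1 : ((const_mx 1 : 'rV[R]_n) <= M)%MS.
Hypothesis B1E : (B1 :=: ker_vop M')%MS.
Hypothesis BE : (col_mx B1 B2 :=: ker_vop M)%MS.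
Hypothesis oB : orthonormal_rows (fisher q) (col_mx B1 B2).

Definition rescaled (N : nat) (y : 'rV[R]_(s + k)) : 'rV[R]_n :=
  q + y *m (root_scale N *: col_mx B1 B2).

Let rescaledE N y : rescaled N y = q + root_scale N *: (y *m col_mx B1 B2).
Proof. by rewrite /rescaled -scalemxAr. Qed.

Let sum_ker0 m (y : 'rV[R]_m) (B : 'M[R]_(m, n)) :
  (B <= ker_vop M)%MS -> \sum_e (y *m B) 0 e = 0.
Proof.
by move=> BM; apply: (sum_ker_vop M1); rewrite (submx_trans (submxMl _ _)).
Qed.

Let B2M : (B2 <= ker_vop M)%MS.
Proof. by rewrite -BE -addsmxE addsmxSr. Qed.

Lemma near_rescaled y : \forall N \near \oo, totemplex q M (rescaled N y).
Proof.
have y0 : \sum_e (y *m col_mx B1 B2) 0 e = 0 by apply: sum_ker0; rewrite BE.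
apply: filterS (near_simplex q0 sq y0) => N sN; rewrite rescaledE.
apply/totemplexP; split=> //.
by rewrite addrC addKr scalemx_sub// -BE submxMl.
Qed.

Lemma pearson_rescaled N y :
  pearson (rescaled N y) q = sum_squares y / N.+1%:R.
Proof.
by rewrite rescaledE pearson_scale pearson_fisher// fisher_orthonormal// root_scale_sqr mulrC.
Qed.

Lemma cvg_rescaled_Idiv y :
  N.+1%:R * Idiv (rescaled N y) q @[N --> \oo] --> sum_squares y / 2.
Proof.
under eq_fun do rewrite rescaledE.
rewrite -(fisher_orthonormal y oB) -pearson_fisher//.
by apply: cvg_scaled_Idiv => //; apply: sum_ker0; rewrite BE.
Qed.

Lemma rescaled_Idiv_ge N y : totemplex q M (rescaled N y) ->
  sum_squares y / (2 * (1 + \sum_e (q 0 e)^-1)) <= N.+1%:R * Idiv (rescaled N y) q.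
Proof.
move=> [sy _]; have := Idiv_ge_pearson sy sq q0.
rewrite pearson_rescaled -(ler_pM2l (ltr0Sn R N)); apply: le_trans.
by rewrite mulrA (mulrC _ (sum_squares y / _)) divfK// pnatr_eq0.
Qed.

Let oB12 : [/\ B1 *m fisher q *m B2^T = 0 & orthonormal_rows (fisher q) B2].
Proof.
move: oB; rewrite /orthonormal_rows mul_col_mx tr_col_mx mul_col_row.
by rewrite (@scalar_mx_block _ s k) => /eq_block_mx[].
Qed.

Variable proj : 'rV[R]_n -> 'rV[R]_n.
Hypothesis projP : forall x, totemplex q M x ->
  is_Iprojection q (totemplex x M') (proj x).

(** The projection and the point differ by a vector of [ker_vop M'], orthogonal to [B2], so
    they have the same coordinates along [B2]; Bessel's inequality applies. *)
Lemma inner_pearson_ge N y : totemplex q M (rescaled N y) ->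
  sum_squares (rsubmx y) / N.+1%:R <= pearson (proj (rescaled N y)) q.
Proof.
move=> yA; set x := rescaled N y; have [B12 oB2] := oB12.
have [/totemplexP[_]] := projP yA; rewrite -B1E => /submxP[w pE] _.
have -> : proj x = q + (proj x - q) by rewrite addrC subrK.
rewrite pearson_fisher//; apply: le_trans (fisher_bessel q0 _ oB2).
have -> : (proj x - q) *m fisher q *m B2^T = root_scale N *: rsubmx y.
  have -> : proj x - q = (proj x - x) + (x - q) by rewrite addrA subrK.
  rewrite pE /x rescaledE [q + _]addrC addrK.
  rewrite !mulmxDl -!scalemxAl -(mulmxA w) -(mulmxA w) B12 mulmx0 add0r.
  rewrite -{1}(hsubmxK y) mul_row_col !mulmxDl -!mulmxA (mulmxA B1) (mulmxA B2).
  by rewrite B12 oB2 mulmx0 mulmx1 add0r.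
rewrite mulrC -root_scale_sqr /sum_squares mulr_sumr ler_sum// => j _.
by rewrite !mxE exprMn.
Qed.

(** Upper bound: the point of the fibre without component along [B1] competes with the
    projection. Lower bound: either the projection is close to [q], and the quadratic
    approximation reduces it to [inner_pearson_ge], or its divergence stays away from zero
    and the factor [N] makes it large. *)
Lemma cvg_inner_divergence y :
  N.+1%:R * Idiv (proj (rescaled N y)) q @[N --> \oo] -->
  sum_squares (rsubmx y) / 2.
Proof.
have [B12 oB2] := oB12.
set b := rsubmx y; set S := sum_squares b.
have S0 : 0 <= S by apply: sumr_ge0 => j _; exact: sqr_ge0.
have b0 : \sum_e (b *m B2) 0 e = 0 by exact: sum_ker0.
apply/cvgrPdist_le => eps eps0.
(* small enough for [2 * eta * S <= eps], and at most [1 / 4] so that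
   [1 / 2 - 2 * eta] is nonnegative *)
pose eta := eps / (4 * (S + eps)).
have Se : 0 < S + eps by rewrite ltr_wpDl.
have eta0 : 0 < eta by rewrite divr_gt0// mulr_gt0.
have eta_quarter : eta <= 4^-1.
  by rewrite /eta ler_pdivrMr ?mulr_gt0// mulrA mulVf ?pnatr_eq0// mul1r lerDr.
have eta_half : eta <= 2^-1 by apply: le_trans eta_quarter _; lra.
have etaS : 2 * eta * S <= eps.
  have -> : 2 * eta * S = eps * (S / (2 * (S + eps))).
    by rewrite /eta; field; rewrite gt_eqF.
  by rewrite ler_piMr ?(ltW eps0)// ler_pdivrMr ?mulr_gt0//; lra.
pose Q : R := 1 + \sum_e (q 0 e)^-1.
have Q0 : 0 < Q.
  by rewrite ltr_wpDr// sumr_ge0// => i _; rewrite invr_ge0 ltW.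
have qQ e : Q^-1 <= q 0 e.
  rewrite -[leRHS]invrK lef_pV2 ?posrE ?invr_gt0// /Q ler_wpDl// (bigD1 e)//=.
  by rewrite lerDl sumr_ge0// => i _; rewrite invr_ge0 ltW.
have upper : \forall N \near \oo,
    N.+1%:R * Idiv (q + root_scale N *: (b *m B2)) q <= S / 2 + eps.
  apply: (cvgr_le _ (cvg_scaled_Idiv q0 b0)).
  by rewrite pearson_fisher// fisher_orthonormal// ltrDl.
near=> N.
have N0 : 0 < N.+1%:R :> R by [].
have yA : totemplex q M (rescaled N y) by near: N; exact: near_rescaled.
have bs : simplex (q + root_scale N *: (b *m B2)).
  by near: N; exact: near_simplex.
have up : N.+1%:R * Idiv (q + root_scale N *: (b *m B2)) q <= S / 2 + eps.
  by near: N.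
have big : S / 2 * (2 * Q * Q / eta ^+ 2) <= N.+1%:R.
  near: N; apply: filterS (nbhs_infty_ger (S / 2 * (2 * Q * Q / eta ^+ 2))) => N.
  by move/le_trans; apply; rewrite ler_nat.
set x := rescaled N y in yA *.
have [projA projmin] := projP yA.
rewrite ler_distlC; apply/andP; split.
  have pe := inner_pearson_ge yA; rewrite -/x -/b -/S in pe.
  apply: (@le_trans _ _ ((2^-1 - 2 * eta) * S)); first by move: etaS; lra.
  have [sproj _] := projA.
  have [small|] := pselect (forall e, `|proj x 0 e / q 0 e - 1| <= eta).
    have pq : \sum_e proj x 0 e = \sum_e q 0 e by rewrite sproj.2 sq.2.
    have := Idiv_taylor q0 pq eta_half small.
    rewrite ler_norml => /andP[taylor _].
    have NP : S <= N.+1%:R * pearson (proj x) q by rewrite mulrC -ler_pdivrMr.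
    have eta2 : 0 <= 2^-1 - 2 * eta by lra.
    apply: le_trans (ler_wpM2l eta2 NP) _.
    by rewrite mulrCA ler_pM2l//; lra.
  move=> /existsNP[e /negP]; rewrite -ltNge => big_e.
  have eta2 : eta ^+ 2 <= (proj x 0 e / q 0 e - 1) ^+ 2.
    by rewrite -[leRHS]real_normK ?num_real// lerXn2r ?nnegrE ?normr_ge0 ?(ltW eta0) ?(ltW big_e).
  have Pe : Q^-1 * eta ^+ 2 <= pearson (proj x) q.
    rewrite /pearson (bigD1 e)//= ler_wpDr//.
      by rewrite sumr_ge0// => i _; rewrite divr_ge0 ?sqr_ge0// ltW.
    have -> : (proj x 0 e - q 0 e) ^+ 2 / q 0 e =
        q 0 e * (proj x 0 e / q 0 e - 1) ^+ 2 by field; rewrite gt_eqF.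
    by rewrite ler_pM ?invr_ge0 ?(ltW Q0) ?sqr_ge0.
  apply: (@le_trans _ _ (S / 2)).
    have etaS0 : 0 <= 2 * eta * S by exact: mulr_ge0 (mulr_ge0 (ler0n _ _) (ltW eta0)) S0.
    lra.
  apply: (@le_trans _ _ (N.+1%:R * (Q^-1 * eta ^+ 2 / (2 * Q)))).
    rewrite -ler_pdivrMr//; last first.
      by apply: divr_gt0; apply: mulr_gt0; rewrite ?invr_gt0 ?exprn_gt0.
    apply: le_trans big; rewrite le_eqVlt; apply/orP; left; apply/eqP.
    by field; rewrite !gt_eqF.
  rewrite ler_pM2l//; apply: le_trans (Idiv_ge_pearson sproj sq q0).
  by rewrite -/Q ler_wpM2r// invr_ge0 mulr_ge0// ltW.
apply: le_trans up; rewrite ler_pM2l//; apply: projmin.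
apply/totemplexP; split=> //.
rewrite /x rescaledE opprD addrACA subrr add0r -scalerBr scalemx_sub//.
rewrite -[y]hsubmxK mul_row_col -/b opprD addrCA subrr addr0 -scaleN1r.
by rewrite scalemx_sub// -B1E submxMl.
Unshelve. all: by end_near. Qed.

End inner_divergence_limit.

(** * Convergence of the distribution functions *)

Section dominated_ratio.
Local Open Scope ereal_scope.
Context d (T : measurableType d) {R : realType} (mu : {measure set T -> \bar R}).
Variables (w_ : nat -> T -> R) (w g : T -> R) (E_ : nat -> set T) (E : set T).
Variables (c : nat -> R) (F : nat -> \bar R).
Hypotheses (mw_ : forall N, measurable_fun setT (w_ N)) (mw : measurable_fun setT w).
Hypotheses (mE_ : forall N, measurable (E_ N)) (mE : measurable E).
Hypothesis w_ge0 : forall N x, (0 <= w_ N x)%R.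
Hypothesis w_le : forall N x, (w_ N x <= g x)%R.
Hypothesis ig : mu.-integrable setT (EFin \o g).
Hypothesis w_w : forall x, w_ ^~ x @ \oo --> w x.
Hypothesis E_E : {ae mu, forall x, \forall N \near \oo, (x \in E_ N) = (x \in E)}.
Hypothesis w1 : \int[mu]_x (w x)%:E = 1.
Hypothesis FE : forall N, F N = (c N)%:E * \int[mu]_(x in E_ N) (w_ N x)%:E.
Hypothesis c1 : forall N, 1 = (c N)%:E * \int[mu]_x (w_ N x)%:E.

(** The constants [c N] cancel: [F N] is the quotient of an integral over [E_ N] by an
    integral over the whole space, and dominated convergence applies to both. *)
Lemma dominated_ratio_cvg : F @ \oo --> \int[mu]_(x in E) (w x)%:E.
Proof.
pose f_ N := (EFin \o w_ N) \_ (E_ N).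
pose f := (EFin \o w) \_ E.
have mf_ N : measurable_fun setT (f_ N).
  apply/(measurable_restrictT _ (mE_ N))/measurable_funTS.
  by apply/measurable_EFinP; exact: mw_.
have mf : measurable_fun setT f.
  by apply/(measurable_restrictT _ mE)/measurable_funTS; apply/measurable_EFinP.
have mEw_ N : measurable_fun setT (EFin \o w_ N) by apply/measurable_EFinP; exact: mw_.
have mEw : measurable_fun setT (EFin \o w) by exact/measurable_EFinP.
have Ew_w x : (EFin \o w_ N) x @[N --> \oo] --> (EFin \o w) x.
  by apply/fine_cvgP; split; [exact: nearW|exact: w_w].
have w_abs N x : `|(EFin \o w_ N) x| <= (EFin \o g) x.
  by rewrite /= lee_fin ger0_norm.
have [iw _ cJ] := dominated_convergence measurableT mEw_ mEw
  (aeW mu (fun x _ => Ew_w x)) ig (aeW mu (fun x N _ => w_abs N x)).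
have f_f : {ae mu, forall x, setT x -> f_ ^~ x @ \oo --> f x}.
  apply: filterS E_E => x xE _; rewrite /f_ /f.
  have -> : ((EFin \o w) \_ E) x = (if x \in E then w x else 0%R)%:E.
    by rewrite patchE; case: ifP.
  apply/fine_cvgP; split; first by apply: nearW => N; rewrite patchE; case: ifP.
  have H : (if x \in E then w_ N x else 0%R) @[N --> \oo] -->
      (if x \in E then w x else 0%R).
    by case: ifP => _; [exact: w_w|exact: cvg_cst].
  apply: cvg_trans H; apply: near_eq_cvg.
  by apply: filterS xE => N /= <-; rewrite patchE; case: ifP.
have f_abs N x : `|f_ N x| <= (EFin \o g) x.
  have -> : f_ N x = (if x \in E_ N then w_ N x else 0%R)%:E.
    by rewrite /f_ patchE; case: ifP.
  case: ifP => _; first exact: w_abs.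
  by rewrite /= normr0 lee_fin (le_trans (w_ge0 N x)).
have [if_ _ cI] := dominated_convergence measurableT mf_ mf f_f ig
  (aeW mu (fun x N _ => f_abs N x)).
have iw_ N : mu.-integrable setT (EFin \o w_ N).
  apply: le_integrable ig => // x _; rewrite (le_trans (w_abs N x))//.
  by rewrite lee_abs.
have if_N N : mu.-integrable setT (f_ N).
  apply: le_integrable ig => // x _; rewrite (le_trans (f_abs N x))//.
  by rewrite lee_abs.
have finJ N : \int[mu]_x (w_ N x)%:E \is a fin_num := integrable_fin_num measurableT (iw_ N).
have finI N : \int[mu]_x f_ N x \is a fin_num := integrable_fin_num measurableT (if_N N).
pose J N := fine (\int[mu]_x (w_ N x)%:E).
pose I N := fine (\int[mu]_x f_ N x).
have JE N : \int[mu]_x (w_ N x)%:E = (J N)%:E by rewrite fineK.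
have IE N : \int[mu]_(x in E_ N) (w_ N x)%:E = (I N)%:E.
  by rewrite integral_mkcond fineK.
have cJ1 N : (c N * J N = 1)%R by apply: EFin_inj; rewrite EFinM -JE -c1.
have cE N : c N = (J N)^-1%R.
  have J0 : J N != 0%R.
    by apply/eqP => J0; have /eqP := cJ1 N; rewrite J0 mulr0 eq_sym oner_eq0.
  by apply: (mulIf J0); rewrite cJ1 mulVf.
have FE' N : F N = ((J N)^-1 * I N)%:E by rewrite FE IE cE.
have {}cJ : J @ \oo --> (1 : R)%R by apply: fine_cvg; rewrite -w1; exact: cJ.
have finIoo : \int[mu]_x f x \is a fin_num := integrable_fin_num measurableT if_.
have {}cI : I @ \oo --> fine (\int[mu]_x f x).
  by apply: fine_cvg; rewrite fineK//; exact: cI.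
rewrite integral_mkcond -/f -(fineK finIoo).
apply/fine_cvgP; split; first by apply: nearW => N; rewrite FE'.
have -> : fine \o F = (fun N => (J N)^-1 * I N)%R.
  by apply/funext => N; rewrite /= FE'.
rewrite -[X in _ --> X]mul1r -[1%R in X in _ --> X]invr1.
by apply: cvgM => //; apply: cvgV => //; exact: oner_neq0.
Qed.

End dominated_ratio.

Section chi_squared_atoms.
Context {R : realType}.
Local Open Scope ereal_scope.

(** The mass at [t] is at most the increment of the distribution function between any
    [s < t] and [t]. *)
Lemma continuous_cdf_no_atom (mu : probability R R) (t : R) :
  {for t, continuous (fun s : R => fine (mu `]-oo, s]%classic))} -> mu [set t] = 0.
Proof.
move=> ct; pose G (s : R) := fine (mu `]-oo, s]%classic).
have fin A : measurable A -> mu A \is a fin_num by move=> mA; exact: fin_num_measure.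
have Gle s : (s < t)%R -> (fine (mu [set t]) <= G t - G s)%R.
  move=> st; rewrite lerBrDr -lee_fin EFinD /G !fineK ?fin// addeC -measureU//.
    apply: le_measure; rewrite ?inE//; first exact: measurableU.
    by move=> x /= [|->]; rewrite !in_itv/=// => /le_trans; apply; exact: ltW.
  by apply/seteqP; split=> x //= [+ xt]; rewrite xt in_itv/= leNgt st.
apply/eqP; rewrite eq_le measure_ge0 andbT -(fineK (fin _ (measurable_set1 t))) lee_fin.
apply/ler_addgt0Pl => e e0; rewrite addr0.
have /cvgrPdist_lt/(_ e e0) := ct.
move=> /nbhs_ballP[dl /= dl0 H].
have : ball t dl (t - dl / 2)%R.
  by rewrite /ball/= opprB addrC subrK gtr0_norm ?divr_gt0// ltr_pdivrMr// ltr_pMr// ltr1n.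
move/H => /= {}H; apply: le_trans (ltW H); apply: le_trans (ler_norm _).
by apply: Gle; rewrite ltrBlDr ltrDl divr_gt0.
Qed.

End chi_squared_atoms.

Section sublevels.
Context d (T : measurableType d) {R : realType}.

Lemma measurable_fun_sublevel (f : T -> R) :
  (forall t, measurable [set x | f x <= t]) -> measurable_fun setT f.
Proof.
move=> mf; apply: (measurability _ (RGenOInfty.measurableE R)).
move=> _ [_ [t ->] <-]; rewrite setTI.
rewrite (_ : _ @^-1` _ = ~` [set x | f x <= t]); first exact: measurableC.
apply/seteqP; split=> x /=; rewrite in_itv/= andbT ltNge; first by move/negP.
by move/negP.
Qed.

End sublevels.

Section change_of_variables.
Context {R : realType} {n s : nat}.
Local Open Scope ereal_scope.

Lemma integral_lebesgue_affine m (q : 'rV[R]_n) (V : 'M[R]_(m, n)) (B : 'M[R]_(s, n)) :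
  row_free B -> (B :=: V)%MS ->
  exists2 c : R, (0 < c)%R & forall (f : 'rV[R]_n -> \bar R) S,
    measurable S -> measurable_fun S f -> (forall x, S x -> 0 <= f x) ->
    \int[lebesgue_affine q V]_(x in S) f x =
    c%:E * \int[lebesgue_rV R s]_(y in (fun y => q + y *m B)%R @^-1` S)
             f (q + y *m B)%R.
Proof.
move=> fB BV; have [c c0 cE] := lebesgue_affineE q fB BV.
exists c => // f S mS mf f0.
have mphi : measurable_fun setT (fun y : 'rV[R]_s => q + y *m B)%R.
  apply/measurable_fun_rVP => j; under eq_fun do rewrite mxE.
  apply: measurable_funD => //.
  exact: (measurableT_comp (measurable_rV_coor j) (measurable_mulmxr B)).
pose nu : {measure set 'rV[R]_n -> \bar R} :=
  measure_function_pushforward__canonical__measure_function_Measure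
    (lebesgue_rV R s) mphi.
rewrite (eq_measure_integral (mscale (NngNum (ltW c0)) nu)); last first.
  by move=> A mA _; rewrite cE.
rewrite ge0_integral_mscale//.
by rewrite (ge0_integral_pushforward mphi)// => x /[!inE]; exact: f0.
Qed.

End change_of_variables.

Section inner_statistic.
Context {R : realType} {n D D' : nat}.
Variables (M : 'M[R]_(D, n)) (M' : 'M[R]_(D', n)) (g ups q : 'rV[R]_n).
Variable proj : 'rV[R]_n -> 'rV[R]_n.
Hypotheses (ups0 : forall e, 0 < ups 0 e) (q0 : forall e, 0 < q 0 e).
Hypothesis irrM : irreducible_vector_operator M.
Hypothesis impM : vop_implies M' M.
Hypothesis qP : is_Iprojection ups (totemplex g M) q.
Hypothesis projP : forall x, totemplex g M x -> is_Iprojection ups (totemplex x M') (proj x).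

Let A := totemplex g M.
Let kerS : (ker_vop M' <= ker_vop M)%MS. Proof. exact: ker_vop_implies. Qed.

Let AE : A = totemplex q M.
Proof.
have [_ qg] := (totemplex_mulmx g M q).1 qP.1.
by apply/seteqP; split=> x /totemplex_mulmx[sx xg]; apply/totemplex_mulmx;
  rewrite ?qg // xg qg.
Qed.

Let projqA x : A x -> is_Iprojection q (totemplex x M') (proj x).
Proof. move=> Ax; exact: inner_Iprojection ups0 q0 kerS qP Ax (projP Ax). Qed.

Lemma measurable_inner_divergence_sublevel t :
  measurable [set x | A x /\ Idiv (proj x) q <= t].
Proof.
have := measurable_inner_sublevel g t q0 kerS; congr measurable.
apply/seteqP; split=> x /= [Ax].
  move=> [z zx zt]; split=> //; apply: le_trans zt.
  by have [_] := projqA Ax; exact.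
by move=> xt; split=> //; exists (proj x) => //; have [] := projqA Ax.
Qed.

Lemma measurable_inner_statistic d (T : measurableType d) (p : T -> 'rV[R]_n) (c : R) :
  measurable_fun setT p -> (forall w, A (p w)) ->
  measurable_fun setT (fun w => c * Idiv (proj (p w)) q).
Proof.
move=> mp pA; apply: measurable_funM => //.
apply: measurable_fun_sublevel => t.
rewrite (_ : [set x | _] = p @^-1` [set x | A x /\ Idiv (proj x) q <= t]).
  exact: measurable_preimage mp (measurable_inner_divergence_sublevel t).
by apply/seteqP; split=> w /= => [H|[]//]; split.
Qed.

Local Open Scope ereal_scope.

Section law.
Variables (s k : nat) (B1 : 'M[R]_(s, n)) (B2 : 'M[R]_(k, n)).
Hypothesis B1E : (B1 :=: ker_vop M')%MS.
Hypothesis BE : (col_mx B1 B2 :=: ker_vop M)%MS.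
Hypothesis oB : orthonormal_rows (fisher q) (col_mx B1 B2).

Local Notation resc := (rescaled q B1 B2).

Let measurable_resc N : measurable_fun setT (resc N).
Proof.
apply/measurable_fun_rVP => j; under eq_fun do rewrite mxE.
apply: measurable_funD => //.
exact: (measurableT_comp (measurable_rV_coor j) (measurable_mulmxr _)).
Qed.

(** Up to a constant, the density of the law at the point with rescaled coordinates [y];
    the first factor makes the standard Gaussian density its limit. *)
Definition weight N (y : 'rV[R]_(s + k)) : R :=
  (normal_peak 1 ^+ (s + k) * (\1_A (resc N y) *
     expR (- (N.+1%:R * Idiv (resc N y) q))))%R.

Let measurable_indicA N : measurable_fun setT (fun y => \1_A (resc N y) : R).
Proof.
apply: (measurableT_comp _ (measurable_resc N)).
exact: measurable_indic (measurable_totemplex g M).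
Qed.

Lemma measurable_weight N : measurable_fun setT (weight N).
Proof.
apply: measurable_funM => //; apply: measurable_funM => //.
apply: measurableT_comp => //; apply: measurableT_comp => //.
apply: measurable_funM => //.
exact: (measurableT_comp (measurable_Idiv q0) (measurable_resc N)).
Qed.

Lemma weight_ge0 N y : (0 <= weight N y)%R.
Proof.
by rewrite /weight mulr_ge0 ?exprn_ge0 ?normal_peak_ge0// mulr_ge0 ?expR_ge0.
Qed.

(** The constant absorbs the normalization of the density, the factor between Lebesgue
    measures and the term [Idiv q ups] of the Pythagorean identity. *)
Lemma density_rescaled N d (T : measurableType d) (P : probability T R)
    (p : {RV P >-> 'rV[R]_n}) :
  has_density_proportional_to p (lebesgue_affine q (ker_vop M)) A
    (fun x => expR (- (N.+1%:R * Idiv x ups)))%R ->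
  exists c : R, forall S, measurable S ->
    distribution P p S =
    c%:E * \int[lebesgue_rV R (s + k)]_(y in resc N @^-1` S) (weight N y)%:E.
Proof.
move=> [_ [c c0 pE]].
have r0 : root_scale N != 0%R :> R by rewrite gt_eqF// root_scale_gt0.
have rBE : (root_scale N *: col_mx B1 B2 :=: col_mx B1 B2)%MS by exact: eqmx_scale.
have fB : row_free (root_scale N *: col_mx B1 B2).
  by rewrite /row_free rBE; exact: (orthonormal_row_free oB).
have [C C0 CE] := integral_lebesgue_affine q fB (eqmx_trans rBE BE).
have p0 : (0 < normal_peak 1 ^+ (s + k) :> R)%R.
  by rewrite exprn_gt0// normal_peak_gt0// oner_neq0.
pose K : R := (c * expR (- (N.+1%:R * Idiv q ups)) / normal_peak 1 ^+ (s + k))%R.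
have K0 : (0 <= K)%R by rewrite divr_ge0 ?(ltW p0)// mulr_ge0 ?expR_ge0// ltW.
exists (C * K)%R => S mS.
have mA := measurable_totemplex g M.
have mSA : measurable (S `&` A) by exact: measurableI.
rewrite pE// CE//; first last.
- by move=> x _; rewrite lee_fin mulr_ge0 ?expR_ge0// ltW.
- apply/measurable_EFinP; apply: measurable_funTS; apply: measurable_funM => //.
  apply: measurableT_comp => //; apply: measurableT_comp => //.
  by apply: measurable_funM => //; exact: measurable_Idiv.
rewrite EFinM -muleA; congr (_ * _).
have mw : measurable_fun (resc N @^-1` S) (fun y => (weight N y)%:E).
  by apply/measurable_EFinP; apply: measurable_funTS; exact: measurable_weight.
rewrite -ge0_integralZl_EFin//; first last.
- by move=> y _; rewrite lee_fin weight_ge0.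
- exact: measurable_preimage (measurable_resc N) mS.
rewrite [LHS]integral_mkcond [RHS]integral_mkcond.
apply: eq_integral => y _; rewrite !patchE.
have -> : (y \in (fun y => q + y *m (root_scale N *: col_mx B1 B2))%R @^-1` (S `&` A)) =
    (y \in resc N @^-1` S) && (resc N y \in A).
  by apply/idP/andP; rewrite !inE => -[]; split.
have [yS|yS] := boolP (y \in resc N @^-1` S) => //=.
have [yA|yA] := boolP (resc N y \in A); last first.
  by rewrite /weight indicE (negbTE yA) mul0r mulr0 mule0.
rewrite /weight indicE yA mul1r -EFinM; congr EFin.
move: yA; rewrite inE => yA.
rewrite -/(resc N y) (Iprojection_pythagoras ups0 q0 qP yA) mulrDr opprD expRD.
by rewrite /K; field; exact: lt0r_neq0.
Qed.

Let projqA' x : totemplex q M x -> is_Iprojection q (totemplex x M') (proj x).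
Proof. by rewrite -AE; exact: projqA. Qed.

Let q_simplex : simplex q. Proof. by case: qP => -[]. Qed.

Let M1 : ((const_mx 1%R : 'rV[R]_n) <= M)%MS. Proof. by case: irrM. Qed.

Let near_A y : \forall N \near \oo, A (resc N y).
Proof. by rewrite AE; exact: near_rescaled. Qed.

Let gauss_pdf1E (y : 'rV[R]_(s + k)) :
  gauss_pdf 1 y = (normal_peak 1 ^+ (s + k) * expR (- (sum_squares y / 2)))%R.
Proof. by rewrite /gauss_pdf expr1n. Qed.

Lemma cvg_weight y : weight N y @[N --> \oo] --> gauss_pdf 1 y.
Proof.
rewrite gauss_pdf1E.
have H : (normal_peak 1 ^+ (s + k) * expR (- (N.+1%:R * Idiv (resc N y) q)))%R
    @[N --> \oo] --> (normal_peak 1 ^+ (s + k) * expR (- (sum_squares y / 2)))%R.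
  apply: cvgM; first exact: cvg_cst.
  apply: continuous_cvg; first exact: continuous_expR.
  by apply: cvgN; exact: (@cvg_rescaled_Idiv _ _ _ _ _ _ M).
apply: cvg_trans H; apply: near_eq_cvg; apply: filterS (near_A y) => N yA.
by rewrite /weight indicE mem_set// mul1r.
Qed.

Let Cq : R := (2 * (1 + \sum_e (q 0 e)^-1))^-1%R.

Lemma weight_le N y :
  (weight N y <= normal_peak 1 ^+ (s + k) * expR (- (Cq * sum_squares y)))%R.
Proof.
rewrite /weight ler_wpM2l ?exprn_ge0 ?normal_peak_ge0// indicE.
have [yA|yA] := boolP (resc N y \in A); last by rewrite mul0r expR_ge0.
rewrite mul1r ler_expR lerN2 mulrC.
by move: yA; rewrite inE AE; exact: rescaled_Idiv_ge.
Qed.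

Lemma integrable_weight_bound : (lebesgue_rV R (s + k)).-integrable setT
  (EFin \o (fun y => normal_peak 1 ^+ (s + k) * expR (- (Cq * sum_squares y)))%R).
Proof.
have C0 : (0 < Cq)%R.
  rewrite invr_gt0 mulr_gt0// ltr_wpDr// sumr_ge0// => i _.
  by rewrite invr_ge0 ltW.
have := integrableZl measurableT (normal_peak 1 ^+ (s + k))%R
  (integrable_gauss (s + k) C0).
by apply: eq_integrable.
Qed.

(** The marginals of a standard Gaussian vector are standard Gaussian
    ([rV_power_rsubmx]). *)
Lemma chi_squaredE (S : set R) : measurable S ->
  chi_squared k S =
  \int[lebesgue_rV R (s + k)]_(y in
     (fun y => sum_squares (rsubmx y : 'rV[R]_k)) @^-1` S) (gauss_pdf 1 y)%:E.
Proof.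
move=> mS.
have m1 : measurable (@sum_squares R k @^-1` S).
  exact: measurable_preimage (@measurable_sum_squares R k) mS.
have mr : measurable_fun setT (fun y : 'rV[R]_(s + k) => rsubmx y).
  apply/measurable_fun_rVP => j; under eq_fun do rewrite mxE.
  exact: measurable_rV_coor.
rewrite -rV_power_normal ?oner_neq0//; last exact: (measurable_preimage mr m1).
by rewrite [RHS](@rV_power_rsubmx R (@normal_prob R 0 1) s k _ m1).
Qed.

Lemma cvg_rescaled_statistic y :
  (2 * N.+1%:R * Idiv (proj (resc N y)) q)%R @[N --> \oo] -->
  sum_squares (rsubmx y).
Proof.
under eq_fun do rewrite -mulrA.
rewrite (_ : sum_squares _ = 2 * (sum_squares (rsubmx y) / 2))%R; last first.
  by rewrite mulrCA mulfV ?mulr1// pnatr_eq0.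
apply: cvgM; first exact: cvg_cst.
exact: (cvg_inner_divergence q0 q_simplex M1 B1E BE oB projqA').
Qed.

Lemma cdf_inner_statistic_cvg (d : nat -> measure_display)
    (Omega : forall N, measurableType (d N)) (P : forall N, probability (Omega N) R)
    (p : forall N, {RV (P N) >-> 'rV[R]_n}) (X : forall N, {RV (P N) >-> R}) :
  (forall N, has_density_proportional_to (p N) (lebesgue_affine q (ker_vop M)) A
    (fun x => expR (- (N%:R * Idiv x ups)))%R) ->
  (forall N w, X N w = 2 * N%:R * Idiv (proj (p N w)) q)%R ->
  cvg_in_distribution X (chi_squared k).
Proof.
move=> pdens XE t ct; rewrite -cvg_shiftS.
pose S N := [set x | A x /\ (2 * N.+1%:R * Idiv (proj x) q <= t)%R].
have N0 N : (0 < 2 * N.+1%:R :> R)%R by rewrite mulr_gt0.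
have mS N : measurable (S N).
  have := measurable_inner_divergence_sublevel (t / (2 * N.+1%:R))%R.
  by congr measurable; apply/seteqP; split=> x /=; rewrite ler_pdivlMr// mulrC.
have /choice[c cE] N := density_rescaled (pdens N.+1).
suff : (fun N => cdf (X N.+1) t) @ \oo --> chi_squared k `]-oo, t]%classic by [].
rewrite chi_squaredE//.
pose Z := (fun y : 'rV[R]_(s + k) => sum_squares (rsubmx y)) @^-1` [set t].
have mss : measurable_fun setT (fun y : 'rV[R]_(s + k) => sum_squares (rsubmx y)).
  apply: measurableT_comp; first exact: measurable_sum_squares.
  apply/measurable_fun_rVP => j; under eq_fun do rewrite mxE.
  exact: measurable_rV_coor.
have mZ : measurable Z by apply: measurable_preimage mss _.
have aeZ : {ae lebesgue_rV R (s + k), forall y, ~ Z y}.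
  have /ae_eq_integral_abs : measurable_fun Z (fun y => (gauss_pdf 1 y)%:E).
    by apply/measurable_EFinP; apply: measurable_funTS; exact: measurable_gauss_pdf.
  move=> /(_ (lebesgue_rV R (s + k)) mZ)[+ _].
  under eq_integral do rewrite gee0_abs ?lee_fin ?gauss_pdf_ge0//.
  rewrite -chi_squaredE// (@continuous_cdf_no_atom R (chi_squared k) t ct) => /(_ erefl).
  apply: filterS => y + Zy => /(_ Zy) [] /eqP; rewrite gauss_pdf1E gt_eqF//.
  by rewrite mulr_gt0 ?expR_gt0// exprn_gt0// normal_peak_gt0// oner_neq0.
apply: (@dominated_ratio_cvg _ _ _ (lebesgue_rV R (s + k)) weight (@gauss_pdf R 1 (s + k))
  (fun y => normal_peak 1 ^+ (s + k) * expR (- (Cq * sum_squares y)))%R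
  (fun N => resc N @^-1` S N) _ c).
- exact: measurable_weight.
- exact: measurable_gauss_pdf.
- by move=> N; exact: measurable_preimage (measurable_resc N) (mS N).
- exact: measurable_preimage mss _.
- exact: weight_ge0.
- exact: weight_le.
- exact: integrable_weight_bound.
- exact: cvg_weight.
- apply: filterS aeZ => y; rewrite /Z /= => /eqP.
  have cy := @cvg_rescaled_statistic y.
  rewrite neq_lt => /orP[lt_t|gt_t].
    near=> N.
    have yA : A (resc N y) by near: N; exact: near_A.
    have yt : (2 * N.+1%:R * Idiv (proj (resc N y)) q < t)%R.
      by near: N; exact: (cvgr_lt _ cy).
    rewrite [RHS]mem_set; last by rewrite /= in_itv/= ltW.
    by rewrite mem_set//; split=> //; exact: ltW.
  near=> N.
  have yt : (t < 2 * N.+1%:R * Idiv (proj (resc N y)) q)%R.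
    by near: N; exact: (cvgr_gt _ cy).
  rewrite [RHS]memNset; last by rewrite /= in_itv/= leNgt gt_t.
  by rewrite memNset// => -[_]; rewrite leNgt yt.
- exact: integral_gauss_pdf (oner_neq0 R).
- move=> N /=; rewrite -cE// /cdf /distribution /pushforward; congr (P _ _).
  apply/seteqP; split=> w /=; rewrite in_itv/= XE /S/=; last by case.
  by split=> //; have [] := pdens N.+1.
- move=> N; rewrite -[X in _ * \int[_]_(x in X) _](preimage_setT (resc N)).
  by rewrite -cE// probability_setT.
Unshelve. all: by end_near. Qed.

End law.
End inner_statistic.

(** * The limit theorem *)

Theorem theorem4p2 (R : realType) (T : finType) (Dstar : {set T})
  (f upsilon : T -> R) (D D' : nat)
  (M : 'M[R]_(D, #|Dstar|)) (M' : 'M[R]_(D', #|Dstar|))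
  (q : 'rV[R]_#|Dstar|) (q' : 'rV[R]_#|Dstar| -> 'rV[R]_#|Dstar|)
  (d : nat -> measure_display) (Omega : forall N : nat, measurableType (d N))
  (P : forall N : nat, probability (Omega N) R)
  (p : forall N : nat, {RV (P N) >-> 'rV[R]_#|Dstar|})
  (Dstar_nonempty : exists e, e \in Dstar)
  (f_distr : is_distribution f)
  (f_supp : forall e, e \notin Dstar -> f e = 0)
  (upsilon_distr : is_distribution upsilon)
  (upsilon_gt0 : forall e, e \in Dstar -> 0 < upsilon e)
  (irrM : irreducible_vector_operator M)
  (irrM' : irreducible_vector_operator M')
  (ltDD' : (D < D')%N)
  (impM : vop_implies M' M)
  (q_proj : is_Iprojection (on_admissible Dstar upsilon)
              (totemplex (on_admissible Dstar f) M) q)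
  (q_gt0 : forall e, 0 < q 0 e)
  (q'_proj : forall x, totemplex (on_admissible Dstar f) M x ->
     is_Iprojection (on_admissible Dstar upsilon) (totemplex x M') (q' x))
  (p_density : forall N : nat,
     has_density_proportional_to (p N) (lebesgue_affine q (ker_vop M))
       (totemplex (on_admissible Dstar f) M)
       (fun x => expR (- (N%:R * Idiv x (on_admissible Dstar upsilon))))) :
  [/\ forall x, totemplex (on_admissible Dstar f) M x ->
        totemplex x M' `<=` totemplex (on_admissible Dstar f) M,
      forall x y, totemplex (on_admissible Dstar f) M x ->
        totemplex (on_admissible Dstar f) M y ->
        totemplex x M' = totemplex y M' -> Idiv (q' x) q = Idiv (q' y) q
    & exists X : forall N : nat, {RV (P N) >-> R},
        (forall N w, X N w = 2 * N%:R * Idiv (q' (p N w)) q) /\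
        cvg_in_distribution X (chi_squared (D' - D))].
Proof.
set ups := on_admissible Dstar upsilon in q_proj q'_proj p_density *.
set g := on_admissible Dstar f in q_proj q'_proj p_density *.
have ups0 e : 0 < ups 0 e by rewrite mxE upsilon_gt0// enum_valP.
have kerS : (ker_vop M' <= ker_vop M)%MS by exact: ker_vop_implies.
have innerP x : totemplex g M x -> is_Iprojection q (totemplex x M') (q' x).
  by move=> xA; exact: inner_Iprojection ups0 q_gt0 kerS q_proj xA (q'_proj x xA).
split.
- by move=> x xA; exact: totemplex_trans kerS xA.
- move=> x y xA yA xy.
  have [qx xmin] := innerP _ xA; have [qy ymin] := innerP _ yA.
  by apply/eqP; rewrite eq_le xmin ?ymin// ?xy// -xy.
have mX N : measurable_fun setT (fun w => 2 * N%:R * Idiv (q' (p N w)) q).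
  apply: (measurable_inner_statistic ups0 q_gt0 impM q_proj q'_proj) => //.
  by have [] := p_density N.
pose X N : {RV (P N) >-> R} :=
  HB.pack (fun w => 2 * N%:R * Idiv (q' (p N w)) q)
    (isMeasurableFun.Build _ _ _ _ _ (mX N)).
exists X; split => //.
have [fM M1] := irrM; have [fM' _] := irrM'.
have [B1 B1E oB1] := orthonormal_basis (fisher_sym q) (fisher_pos q_gt0)
  (mxrank_ker_vop fM').
have B1M : (B1 <= ker_vop M)%MS by rewrite B1E.
have kE : (D' - D)%N = (\rank (ker_vop M) - (#|Dstar| - D'))%N.
  have := rank_leq_col M'; rewrite (eqP fM') mxrank_ker_vop//.
  by move: ltDD'; lia.
have [B2 BE oB] := orthonormal_basis_extension (fisher_sym q) (fisher_pos q_gt0)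
  oB1 B1M kE.
exact: (cdf_inner_statistic_cvg ups0 q_gt0 irrM impM q_proj q'_proj B1E BE oB p_density).
Qed.
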